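(* Every tree with $n$ nodes and maximum degree at most 4 has a planar L-shaped drawing on any set of $2n^{1.55}$ points in the plane in general orthogonal position.
   Context: A point set is in general orthogonal position if no two points share the same $x$- or $y$-coordinate. Points are unlabelled: vertices are placed at distinct points of the set, any vertex at any point, and not all points need be used. A planar L-shaped drawing is such a placement in which each edge is drawn as an orthogonal path consisting of one horizontal and one vertical segment (one bend), and no two edges intersect except at a common endpoint. The tree is unordered: the cyclic order of edges around vertices may be chosen freely. *)

(* Defs.v *)
From HB Require Import structures.
From mathcomp Require Import all_boot all_order all_algebra.
From mathcomp Require Import reals.
Set Implicit Arguments. Unset Strict Implicit. Unset Printing Implicit Defensive.
Import Order.TTheory GRing.Theory Num.Theory.
Local Open Scope ring_scope.

Section Defs.
Variable R : realType.

Definition on_seg (a b p : R * R) : Prop :=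
  exists t : R, 0 <= t <= 1 /\
    p = (a.1 + t * (b.1 - a.1), a.2 + t * (b.2 - a.2)).

Definition on_L (a c b p : R * R) : Prop := on_seg a c p \/ on_seg c b p.

Definition gen_orth_pos (P : seq (R * R)) : Prop :=
  uniq P /\ forall p q, p \in P -> q \in P -> p != q -> p.1 != q.1 /\ p.2 != q.2.

Definition planar_L_drawing n (e : rel 'I_n) (P : seq (R * R))
    (f : 'I_n -> R * R) (bend : 'I_n -> 'I_n -> R * R) : Prop :=
  injective f /\ (forall x, f x \in P) /\
  (forall u v, e u v -> bend u v = bend v u /\
       (bend u v = ((f u).1, (f v).2) \/ bend u v = ((f v).1, (f u).2))) /\
  (forall u v w z p, e u v -> e w z ->
       ~ ((u = w /\ v = z) \/ (u = z /\ v = w)) ->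
       on_L (f u) (bend u v) (f v) p -> on_L (f w) (bend w z) (f z) p ->
       exists x, (x = u \/ x = v) /\ (x = w \/ x = z) /\ p = f x).
End Defs.

(* A (finite, simple) tree on the vertex set 'I_n: symmetric irreflexive
   adjacency relation, connected, with no cycle (a cycle = a duplicate-free
   closed walk with at least 3 vertices). *)
Definition is_tree n (e : rel 'I_n) : Prop :=
  symmetric e /\ irreflexive e /\ (forall x y, connect e x y) /\
  (forall c : seq 'I_n, cycle e c -> uniq c -> (size c < 3)%N).

Definition max_degree_le n (e : rel 'I_n) (d : nat) : Prop :=
  forall x, (#|[set y | e x y]| <= d)%N.

(* Main.v *)
Require Import Defs.
From HB Require Import structures.
From mathcomp Require Import all_boot all_order all_algebra.
From mathcomp Require boolp interval_inference convex hoelder.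
From mathcomp Require Import reals exp ring lra zify.
Import Order.TTheory GRing.Theory Num.Theory.
Set Implicit Arguments.
Unset Strict Implicit.
Unset Printing Implicit Defensive.
Local Open Scope ring_scope.

(* Points are reached from their parents by L-shaped edges, and a subtree with
   [n] vertices is drawn on any [c * n^1.55] points in one of three ways:
   (F) with a free ray leaving its root to the left, [c = 2];
   (G) attached to a given point [p] lying to the left of all the points, so
       that everything except the first piece of the edge at [p] stays among the
       points, [c = 2.88];
   (K) as in (G), but with [p] chosen among the points, [c = 2.76] (plus 2).
   For a root with subtrees of sizes [n1 >= n2 >= n3], (F) follows either by
   cutting off a top and a bottom strip for two of the subtrees and drawing the
   third one to the right of the root, all of type (G), or, when [n1] is large,
   by drawing the two larger subtrees with (F) to the right of a vertical strip
   that contains the root and the smallest subtree.  (G) uses (K) for the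
   middle subtree.  For (K) one follows the heavy path of the tree while it
   loses few vertices, hanging its other subtrees in horizontal strips above and
   below; if one of these strips is too thin, (F) applies in a corner.  The
   constants work because each recurrence compares convex homogeneous functions
   of [(n1, n2, n3)] on a polygon, that is, at its vertices. *)

(** * Drawings and their symmetries *)

(** Planarity is handled by regions: every branch comes with a set that contains it, and
    disjointness of these sets replaces all crossing arguments. Type (K) exists because (G) does not
    close on itself. In (G) it is unknown on which side of [p] the usable points lie, which doubles
    the charge for the two smaller subtrees; for two equal halves the charge would be 3 * (1/2)^1.55
    > 1 times the budget. Letting a (K)-drawing of the middle subtree choose the root replaces 3 by
    1 + 2 * 2.76 / 2.88 = 35/12, which just fits. So (K) has to save 1/24 of the cost of (G). Near
    (1, 0, 0) every recurrence is an equality and nothing can be saved; hence the heavy path, which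
    is left as soon as a subtree has lost more than 5 percent of all vertices. The E vertices spent
    on the way are paid from a potential 5.76 * E^1.55, whose superadditivity covers every step.
    Since (F) must still fit if a strip is too thin, the strips may only use 2.76 - 2 = 0.76. *)

Inductive tree (V : Type) : Type :=
  Nil | Node of V & tree V & tree V & tree V.
Arguments Nil {V}.

Section Drawings.
Variables (R : realType) (V : Type).
Local Notation pt := (R * R)%type.
Implicit Types (p q r z : pt) (A B C Q : seq pt) (t : tree V) (Z : pt -> Prop).

Definition btw (a b x : R) := (a <= x <= b) || (b <= x <= a).

(* [b]: the edge leaves [p] vertically. *)
Definition edge p q (b : bool) z : Prop :=
  if b then (z.1 = p.1 /\ btw p.2 q.2 z.2) \/ (z.2 = q.2 /\ btw p.1 q.1 z.1)
  else (z.2 = p.2 /\ btw p.1 q.1 z.1) \/ (z.1 = q.1 /\ btw p.2 q.2 z.2).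

Definition included Z Z' := forall z, Z z -> Z' z.
Definition separated Z Z' := forall z, Z z -> Z' z -> False.

(** [D] stands for the recursive call of [draw], which keeps that fixpoint structural. The end [q]
    of the edge lies in [Z], so disjoint regions already give distinct points to distinct vertices
    and [Q] need not be divided among the subtrees. *)
Definition attach t (D : pt -> (pt -> Prop) -> Prop) Q p Z : Prop :=
  t = Nil \/
  exists q b Z', [/\ q \in Q, q != p, D q Z', included Z' Z &
    forall z, edge p q b z -> z != p -> Z z /\ ~ Z' z].

(* [t] is drawn with root at [r], all other vertices at points of [Q], and all
   of the drawing except [r] inside [Z]. *)
Fixpoint draw Q t r Z : Prop :=
  if t is Node _ t1 t2 t3 then
    exists Z1 Z2 Z3,
      [/\ [/\ included Z1 Z, included Z2 Z & included Z3 Z],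
          [/\ separated Z1 Z2, separated Z1 Z3 & separated Z2 Z3],
          ~ Z r &
          [/\ attach t1 (draw Q t1) Q r Z1, attach t2 (draw Q t2) Q r Z2 &
              attach t3 (draw Q t3) Q r Z3]]
  else True.

(* [branch Q t p Z]: [t] and the edge joining it to its parent at [p]. *)
Definition branch Q t p Z := attach t (draw Q t) Q p Z.

Lemma draw_mono Q Q' t r Z :
  {subset Q <= Q'} -> draw Q t r Z -> draw Q' t r Z.
Proof.
move=> sQ; elim: t r Z => [|v t1 IH1 t2 IH2 t3 IH3] r Z //=.
move=> [Z1 [Z2 [Z3 [sZ dZ nr [b1 b2 b3]]]]]; exists Z1, Z2, Z3; split=> //.
have att t Z' : (forall r Z, draw Q t r Z -> draw Q' t r Z) ->
    attach t (draw Q t) Q r Z' -> attach t (draw Q' t) Q' r Z'.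
  move=> IH [->|[q [b [Zq [qQ qr dq iq eq]]]]]; first by left.
  by right; exists q, b, Zq; split=> //; [exact: sQ | exact: IH].
by split; apply: att.
Qed.

Lemma branch_mono Q Q' t p Z Z' : {subset Q <= Q'} -> included Z Z' ->
  branch Q t p Z -> branch Q' t p Z'.
Proof.
move=> sQ sZ [->|[q [b [Zq [qQ qr dq iq eq]]]]]; first by left.
right; exists q, b, Zq; split=> //; first exact: sQ.
- exact: draw_mono dq.
- by move=> z /iq /sZ.
- by move=> z ez zp; have [/sZ] := eq z ez zp.
Qed.

Definition gp Q := gen_orth_pos Q.

Lemma gp_uniq Q : gp Q -> uniq Q. Proof. by case. Qed.

Lemma gp_sub A Q : uniq A -> {subset A <= Q} -> gp Q -> gp A.
Proof. by move=> uA sA [_ gQ]; split=> // p q /sA pQ /sA qQ; apply: gQ. Qed.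

Lemma gp_neq Q p q : gp Q -> p \in Q -> q \in Q -> p != q ->
  p.1 != q.1 /\ p.2 != q.2.
Proof. by case=> _; apply. Qed.

(** [tau] translates ports: reflections in the axes keep the direction of the first piece of an
    edge, reflections in a diagonal exchange vertical and horizontal. *)
Definition symmetry (s : pt -> pt) : Prop :=
  [/\ involutive s,
      exists tau : bool -> bool,
        forall p q b z, edge (s p) (s q) (tau b) z -> edge p q b (s z) &
      forall p q, p.1 != q.1 -> p.2 != q.2 ->
        (s p).1 != (s q).1 /\ (s p).2 != (s q).2].

Definition flipX p : pt := (- p.1, p.2).
Definition flipY p : pt := (p.1, - p.2).
Definition transp p : pt := (p.2, p.1).
Definition antitransp p : pt := (- p.2, - p.1).

Lemma symmetry_id : symmetry id.
Proof. by split=> //; exists id => p q b z. Qed.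

Lemma symmetry_flipX : symmetry flipX.
Proof.
split=> [[x y]|| p q]; first by rewrite /flipX /= opprK.
- exists id => p q [] [x y]; rewrite /edge /btw /=; lra.
- by rewrite /flipX /= eqr_opp.
Qed.

Lemma symmetry_flipY : symmetry flipY.
Proof.
split=> [[x y]|| p q]; first by rewrite /flipY /= opprK.
- exists id => p q [] [x y]; rewrite /edge /btw /=; lra.
- by rewrite /flipY /= eqr_opp.
Qed.

Lemma symmetry_transp : symmetry transp.
Proof.
split=> [[x y]|| p q] //=.
exists negb => p q [] [x y]; rewrite /edge /btw /=; lra.
Qed.

Lemma symmetry_antitransp : symmetry antitransp.
Proof.
split=> [[x y]|| p q]; first by rewrite /antitransp /= !opprK.
- exists negb => p q [] [x y]; rewrite /edge /btw /=; lra.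
- by rewrite /antitransp /= !eqr_opp.
Qed.

Section Symmetry.
Variables (s : pt -> pt) (sP : symmetry s).

Lemma symK : involutive s. Proof. by case: sP. Qed.

Lemma sym_inj : injective s. Proof. exact: inv_inj symK. Qed.

Lemma map_symK Q : map s (map s Q) = Q.
Proof. by rewrite mapK //; apply: symK. Qed.

Lemma mem_map_sym Q p : (p \in map s Q) = (s p \in Q).
Proof. by rewrite -{1}(symK p) (mem_map sym_inj). Qed.

Lemma gp_sym Q : gp Q -> gp (map s Q).
Proof.
case=> uQ gQ; split; first by rewrite (map_inj_uniq sym_inj).
move=> p q; rewrite !mem_map_sym => pQ qQ pq.
have [|h1 h2] := gQ _ _ pQ qQ; first by rewrite (inj_eq sym_inj).
by case: sP => _ _ /(_ _ _ h1 h2); rewrite !symK.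
Qed.

Lemma draw_sym Q t r Z :
  draw (map s Q) t (s r) Z -> draw Q t r (fun z => Z (s z)).
Proof.
have [_ [tau tauP] _] := sP.
elim: t r Z => [|v t1 IH1 t2 IH2 t3 IH3] r Z //=.
move=> [Z1 [Z2 [Z3 [[i1 i2 i3] [d1 d2 d3] nr [b1 b2 b3]]]]].
exists (fun z => Z1 (s z)), (fun z => Z2 (s z)), (fun z => Z3 (s z)).
split=> //.
- by split=> z; [apply: i1 | apply: i2 | apply: i3].
- by split=> z; [apply: d1 | apply: d2 | apply: d3].
have att t Z' : (forall r Z, draw (map s Q) t (s r) Z ->
      draw Q t r (fun z => Z (s z))) ->
    attach t (draw (map s Q) t) (map s Q) (s r) Z' ->
    attach t (draw Q t) Q r (fun z => Z' (s z)).
  move=> IH [->|[q [b [Zq [qQ qr dq iq eq]]]]]; first by left.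
  right; exists (s q), (tau b), (fun z => Zq (s z)); split.
  - by rewrite -mem_map_sym.
  - by rewrite -(inj_eq sym_inj) symK.
  - by apply: IH; rewrite symK.
  - by move=> z; apply: iq.
  - move=> z ez zr; apply: eq; last by rewrite (inj_eq sym_inj).
    by apply: tauP; rewrite symK.
by split; apply: att.
Qed.

Lemma branch_sym Q t p Z :
  branch (map s Q) t (s p) Z -> branch Q t p (fun z => Z (s z)).
Proof.
have [_ [tau tauP] _] := sP.
move=> [->|[q [b [Zq [qQ qr dq iq eq]]]]]; first by left.
right; exists (s q), (tau b), (fun z => Zq (s z)); split.
- by rewrite -mem_map_sym.
- by rewrite -(inj_eq sym_inj) symK.
- by apply: draw_sym; rewrite symK.
- by move=> z; apply: iq.
- move=> z ez zr; apply: eq; last by rewrite (inj_eq sym_inj).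
  by apply: tauP; rewrite symK.
Qed.

End Symmetry.

Definition below_some (u : pt -> R) Q (v : R) := exists2 q, q \in Q & v <= u q.
Definition above_some (u : pt -> R) Q (v : R) := exists2 q, q \in Q & u q <= v.

Lemma below_some_map (s : pt -> pt) u Q v :
  below_some u (map s Q) v <-> below_some (u \o s) Q v.
Proof.
split=> [[_ /mapP[q qQ ->] h]|[q qQ h]]; first by exists q.
by exists (s q) => //; apply: map_f.
Qed.

Lemma above_some_map (s : pt -> pt) u Q v :
  above_some u (map s Q) v <-> above_some (u \o s) Q v.
Proof.
split=> [[_ /mapP[q qQ ->] h]|[q qQ h]]; first by exists q.
by exists (s q) => //; apply: map_f.
Qed.

(* For [s = id], the region used by a branch on the points [Q] leaving [p]
   through its right port; [transp], [flipX] and [antitransp] give the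
   regions of the up, left and down ports. *)
Definition zone (s : pt -> pt) p Q z : Prop :=
  [/\ (s p).1 < (s z).1, below_some (fst \o s) Q (s z).1,
      below_some (snd \o s) (p :: Q) (s z).2,
      above_some (snd \o s) (p :: Q) (s z).2 &
      (s z).2 = (s p).2 \/ above_some (fst \o s) Q (s z).1].

Lemma zone_map s s' p Q z :
  zone s (s' p) (map s' Q) (s' z) <-> zone (s \o s') p Q z.
Proof.
have e1 (u : pt -> R) (v : R) : below_some u (s' p :: map s' Q) v <->
    below_some (u \o s') (p :: Q) v by apply: (below_some_map s' u (p :: Q)).
have e2 (u : pt -> R) (v : R) : above_some u (s' p :: map s' Q) v <->
    above_some (u \o s') (p :: Q) v by apply: (above_some_map s' u (p :: Q)).
have f1 := below_some_map s' (fst \o s) Q (s (s' z)).1.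
have f2 := above_some_map s' (fst \o s) Q (s (s' z)).1.
have g1 := e1 (snd \o s) (s (s' z)).2.
have g2 := e2 (snd \o s) (s (s' z)).2.
by split=> -[h1 /f1 h2 /g1 h3 /g2 h4 h5]; split=> //; case: h5 => [->|/f2 h];
  [left|right|left|right].
Qed.

Lemma zone_eq s s' p Q z : s =1 s' -> zone s p Q z -> zone s' p Q z.
Proof.
move=> e [h1 [a aQ h2] [b bQ h3] [c cQ h4] h5]; rewrite /zone -!e.
split=> //.
- by exists a; rewrite //= -e.
- by exists b; rewrite //= -e.
- by exists c; rewrite //= -e.
- by case: h5 => [->|[d dQ h5]]; [left|right; exists d; rewrite //= -e].
Qed.

Lemma zone_flipY s p Q z : zone (flipY \o s) p Q z <-> zone s p Q z.
Proof.
split=> -[/= h1 h2 [b bQ /= h3] [c cQ /= h4] h5]; split=> //=.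
- by exists c => //=; lra.
- by exists b => //=; lra.
- by case: h5 => [h|h]; [left; lra|right].
- by exists c => //=; lra.
- by exists b => //=; lra.
- by case: h5 => [h|h]; [left; lra|right].
Qed.

Lemma zone_mono s p A Q z : {subset A <= Q} -> zone s p A z -> zone s p Q z.
Proof.
move=> sA; have sA' : {subset p :: A <= p :: Q}.
  by move=> x; rewrite !inE => /orP[->|/sA ->] //; rewrite orbT.
move=> [h1 [a /sA aQ h2] [b /sA' bQ h3] [c /sA' cQ h4] h5]; split=> //.
- by exists a.
- by exists b.
- by exists c.
- by case: h5 => [->|[d /sA dQ h5]]; [left|right; exists d].
Qed.

Definition hull Q z : Prop :=
  [/\ below_some fst Q z.1, above_some fst Q z.1,
      below_some snd Q z.2 & above_some snd Q z.2].

Lemma hull_mono A Q z : {subset A <= Q} -> hull A z -> hull Q z.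
Proof.
move=> sA [[a /sA ? ?] [b /sA ? ?] [c /sA ? ?] [d /sA ? ?]].
by split; [exists a|exists b|exists c|exists d].
Qed.

Definition basic_symmetry (s : pt -> pt) : Prop :=
  s =1 id \/ s =1 flipX \/ s =1 flipY \/ s =1 transp \/ s =1 antitransp.

Lemma basic_id : basic_symmetry id. Proof. by left. Qed.
Lemma basic_flipX : basic_symmetry flipX. Proof. by right; left. Qed.
Lemma basic_flipY : basic_symmetry flipY. Proof. by right; right; left. Qed.
Lemma basic_transp : basic_symmetry transp.
Proof. by right; right; right; left. Qed.
Lemma basic_antitransp : basic_symmetry antitransp.
Proof. by right; right; right; right. Qed.

Lemma hull_map s Q z : basic_symmetry s -> hull (map s Q) (s z) -> hull Q z.
Proof.
move=> e; case=> /below_some_map[a aQ /= ha]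
  /above_some_map[b bQ /= hb] /below_some_map[c cQ /= hc]
  /above_some_map[d dQ /= hd].
case: e => [|[|[|[]]]] e; move: ha hb hc hd; rewrite !e /= => ha hb hc hd;
  split.
all: solve [(exists a => //=; lra) | (exists b => //=; lra) |
  (exists c => //=; lra) | (exists d => //=; lra)].
Qed.

Definition left_of A B := forall a b : pt, a \in A -> b \in B -> a.1 < b.1.
Definition under A B := forall a b : pt, a \in A -> b \in B -> a.2 < b.2.

End Drawings.
Arguments flipX {R}.
Arguments flipY {R}.
Arguments transp {R}.
Arguments antitransp {R}.

Ltac add_fact pf :=
  let T := type of pf in
  lazymatch goal with
  | _ : T |- _ => fail
  | _ => have := pf; intro
  end.

Ltac order_facts :=
  repeat match goal with
  | H : left_of ?A ?B, a : is_true (?x \in ?A), b : is_true (?y \in ?B) |- _ =>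
      add_fact (H x y a b)
  | H : left_of [:: ?x] ?B, b : is_true (?y \in ?B) |- _ =>
      add_fact (H x y (mem_head x [::]) b)
  | H : under ?A ?B, a : is_true (?x \in ?A), b : is_true (?y \in ?B) |- _ =>
      add_fact (H x y a b)
  | H : under [:: ?x] ?B, b : is_true (?y \in ?B) |- _ =>
      add_fact (H x y (mem_head x [::]) b)
  | H : under ?A [:: ?y], a : is_true (?x \in ?A) |- _ =>
      add_fact (H x y a (mem_head y [::]))
  end.

(** * Strips and extreme points of a point set in general position *)

Section Assembly.
Variables (R : realType) (V : Type).
Local Notation pt := (R * R)%type.
Implicit Types (p q r z : pt) (A B C Q : seq pt) (t : tree V) (Z : pt -> Prop).

Lemma left_of_notin p Q : left_of [:: p] Q -> p \notin Q.
Proof. by move=> h; apply/negP=> /(h p p (mem_head _ _)); rewrite ltxx. Qed.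

Lemma under_notin p Q : under [:: p] Q -> p \notin Q.
Proof. by move=> h; apply/negP=> /(h p p (mem_head _ _)); rewrite ltxx. Qed.

Lemma gp_cons p A Q : gp Q -> p \in Q -> gp A -> {subset A <= Q} ->
  p \notin A -> gp (p :: A).
Proof.
move=> gQ pQ gA sA pA; apply: gp_sub gQ; first by rewrite /= pA gp_uniq.
by move=> x; rewrite inE => /orP[/eqP->|/sA].
Qed.

Lemma gp_tail p A : gp (p :: A) -> gp A.
Proof.
move=> g; apply: gp_sub (g); first by case: g => /= /andP[].
by move=> x xA; rewrite inE xA orbT.
Qed.

Lemma gp_filter (a : pred pt) Q : gp Q -> gp (filter a Q).
Proof.
move=> gQ; apply: gp_sub (gQ); first by rewrite filter_uniq ?gp_uniq.
by move=> x; rewrite mem_filter => /andP[].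
Qed.

Lemma split_by (u : pt -> R) Q k : gp Q ->
  (forall p q, p \in Q -> q \in Q -> p != q -> u p != u q) ->
  (k <= size Q)%N -> exists A B,
  [/\ [/\ gp A, gp B, {subset A <= Q} & {subset B <= Q}], size A = k,
      size B = (size Q - k)%N & forall a b, a \in A -> b \in B -> u a < u b].
Proof.
move=> gQ uQ kQ; pose S := sort (relpre u <=%O) Q.
have tot : total (relpre u (@Order.le _ R)) by move=> x y; apply: le_total.
have trS : transitive (relpre u (@Order.le _ R)).
  by move=> y x z; apply: le_trans.
have pS : perm_eq S Q by rewrite perm_sort.
have uS : uniq (take k S ++ drop k S).
  by rewrite cat_take_drop (perm_uniq pS) gp_uniq.
have sA : {subset take k S <= Q}.
  by move=> x /mem_take; rewrite (perm_mem pS).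
have sB : {subset drop k S <= Q}.
  by move=> x /mem_drop; rewrite (perm_mem pS).
have := uS; rewrite cat_uniq => /and3P[uA /hasPn dis uB].
exists (take k S), (drop k S); split.
- by split=> //; apply: gp_sub gQ.
- by rewrite size_take_min size_sort; lia.
- by rewrite size_drop size_sort.
move=> a b aA bB; rewrite lt_neqAle; apply/andP; split.
  apply: uQ; [exact: sA | exact: sB | apply/eqP=> ab].
  by have := dis b bB; rewrite -ab aA.
have : sorted (relpre u <=%O) (take k S ++ drop k S).
  by rewrite cat_take_drop; apply: sort_sorted.
rewrite sorted_pairwise // pairwise_cat => /and3P[/allrelP h _ _].
exact: h.
Qed.

Lemma split_left Q k : gp Q -> (k <= size Q)%N -> exists A B,
  [/\ [/\ gp A, gp B, {subset A <= Q} & {subset B <= Q}], (k <= size A)%N,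
      (size Q - k <= size B)%N & left_of A B].
Proof.
move=> gQ kQ.
have [|A [B [gAB sA sB lAB]]] := split_by (u := fst) gQ _ kQ.
  by move=> p q pQ qQ pq; have [] := gp_neq gQ pQ qQ pq.
by exists A, B; split=> //; rewrite ?sA ?sB.
Qed.

Lemma split_bottom Q k : gp Q -> (k <= size Q)%N -> exists A B,
  [/\ [/\ gp A, gp B, {subset A <= Q} & {subset B <= Q}], (k <= size A)%N,
      (size Q - k <= size B)%N & under A B].
Proof.
move=> gQ kQ.
have [|A [B [gAB sA sB lAB]]] := split_by (u := snd) gQ _ kQ.
  by move=> p q pQ qQ pq; have [] := gp_neq gQ pQ qQ pq.
by exists A, B; split=> //; rewrite ?sA ?sB.
Qed.

Lemma split_top Q k : gp Q -> (k <= size Q)%N -> exists A B,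
  [/\ [/\ gp A, gp B, {subset A <= Q} & {subset B <= Q}],
      (size Q - k <= size A)%N, (k <= size B)%N & under A B].
Proof.
move=> gQ kQ; have [||A [B [gAB sA sB]]] := @split_bottom Q (size Q - k) => //.
  by rewrite leq_subr.
by exists A, B; split=> //; lia.
Qed.

Lemma split_right Q k : gp Q -> (k <= size Q)%N -> exists A B,
  [/\ [/\ gp A, gp B, {subset A <= Q} & {subset B <= Q}],
      (size Q - k <= size A)%N, (k <= size B)%N & left_of A B].
Proof.
move=> gQ kQ; have [||A [B [gAB sA sB]]] := @split_left Q (size Q - k) => //.
  by rewrite leq_subr.
by exists A, B; split=> //; lia.
Qed.

Lemma extreme_point (u : pt -> R) Q : gp Q -> (0 < size Q)%N ->
  (forall p q, p \in Q -> q \in Q -> p != q -> u p != u q) ->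
  exists p A, [/\ p \in Q, {subset A <= Q}, gp (p :: A),
    (size Q <= (size A).+1)%N & forall a, a \in A -> u p < u a].
Proof.
move=> gQ Q0 uQ.
have [[|p [|? ?]] [A [[_ gA sp sA] //= _ sz l]]] := split_by gQ uQ Q0.
have pQ : p \in Q by apply: sp; rewrite mem_head.
exists p, A; split=> //; last by move=> a; apply: l; rewrite mem_head.
  apply: gp_cons gQ pQ gA sA _.
  by apply/negP=> /(l p p (mem_head _ _)); rewrite ltxx.
by rewrite sz; lia.
Qed.

Lemma leftmost Q : gp Q -> (0 < size Q)%N -> exists p A,
  [/\ p \in Q, {subset A <= Q}, gp (p :: A), (size Q <= (size A).+1)%N &
      left_of [:: p] A].
Proof.
move=> gQ Q0; have [|p [A [pQ sA gA sz l]]] := extreme_point (u := fst) gQ Q0.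
  by move=> p q pQ qQ pq; have [] := gp_neq gQ pQ qQ pq.
by exists p, A; split=> // a b; rewrite inE => /eqP-> /l.
Qed.

Lemma rightmost Q : gp Q -> (0 < size Q)%N -> exists p A,
  [/\ p \in Q, {subset A <= Q}, gp (p :: A), (size Q <= (size A).+1)%N &
      left_of A [:: p]].
Proof.
move=> gQ Q0.
have [|p [A [pQ sA gA sz l]]] := extreme_point (u := fun q => - q.1) gQ Q0.
  by move=> p q pQ qQ pq; have [] := gp_neq gQ pQ qQ pq; rewrite eqr_opp.
by exists p, A; split=> // a b /l + /[!inE] /eqP->; rewrite ltrN2.
Qed.

Lemma lowest Q : gp Q -> (0 < size Q)%N -> exists p A,
  [/\ p \in Q, {subset A <= Q}, gp (p :: A), (size Q <= (size A).+1)%N &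
      under [:: p] A].
Proof.
move=> gQ Q0; have [|p [A [pQ sA gA sz l]]] := extreme_point (u := snd) gQ Q0.
  by move=> p q pQ qQ pq; have [] := gp_neq gQ pQ qQ pq.
by exists p, A; split=> // a b; rewrite inE => /eqP-> /l.
Qed.

Lemma exists_max (u : pt -> R) Q : (0 < size Q)%N ->
  exists2 p, p \in Q & forall q, q \in Q -> u q <= u p.
Proof.
elim: Q => // q [_ _|r Q /(_ isT)[p pQ hp] _].
  by exists q; rewrite ?mem_head // => x; rewrite inE => /eqP->.
have [qp|pq] := leP (u q) (u p).
  by exists p => [|x]; rewrite inE ?pQ ?orbT // => /orP[/eqP->|/hp].
exists q => [|x]; rewrite inE ?eqxx // => /orP[/eqP->//|/hp h].
exact: le_trans h (ltW pq).
Qed.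

Lemma zone_hull (s : pt -> pt) p A Q z : p \in Q -> {subset A <= Q} ->
  basic_symmetry s ->
  zone s p A z -> hull Q z.
Proof.
move=> pQ sA e; have sA' : {subset p :: A <= Q}.
  by move=> x; rewrite !inE => /orP[/eqP->|/sA ->].
move=> [h1 [a /sA aQ h2] [b /sA' bQ h3] [c /sA' cQ h4] h5].
apply: hull_map e _; split.
- by apply/below_some_map; exists a.
- by apply/above_some_map; exists p => //; apply: ltW.
- by apply/below_some_map; exists b.
- by apply/above_some_map; exists c.
Qed.

Lemma hull_zone p Q z : left_of [:: p] Q -> hull Q z -> zone id p Q z.
Proof.
move=> l [[a aQ h1] [b bQ h2] [c cQ h3] [d dQ h4]]; split=> //.
- by order_facts; rewrite /=; lra.
- by exists a.
- by exists c => //; rewrite inE cQ orbT.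
- by exists d => //; rewrite inE dQ orbT.
- by right; exists b.
Qed.

End Assembly.

#[local] Hint Resolve basic_id basic_flipX basic_flipY basic_transp
  basic_antitransp : core.

(** * Compatible ports and the three kinds of drawing *)

Section Drawable.
Variables (R : realType) (V : Type).
Local Notation pt := (R * R)%type.
Implicit Types (p q r z : pt) (A B C Q : seq pt) (t : tree V) (Z : pt -> Prop).

(** Off the line through [p] on which it starts, a zone stays within the range of its own points;
    separating the two point sets in either direction therefore separates the zones. *)
Lemma zone_UR_disj p A B : under B A \/ left_of A B ->
  separated (zone transp p A) (zone id p B).
Proof.
move=> h z; rewrite /zone /below_some /above_some /=.
move=> [u1 _ [a1 + u4] _ u5] [r1 _ [b1 + r4] _ r5].
case: u5 => [?|[a2 a2A u5]]; first lra.
case: r5 => [?|[b2 b2B r5]]; first lra.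
move=> /[!inE] /orP[/eqP?|b1B] /orP[/eqP?|a1A]; subst; try lra.
by case: h => h; order_facts; lra.
Qed.

Lemma zone_UL_disj p A C : under C A \/ left_of C A ->
  separated (zone transp p A) (zone flipX p C).
Proof.
move=> h z; rewrite /zone /below_some /above_some /flipX /=.
move=> [u1 _ _ [a1 + u4] u5] [r1 _ [b1 + r4] _ r5].
case: u5 => [?|[a2 a2A u5]]; first lra.
case: r5 => [?|[b2 b2B r5]]; first lra.
move=> /[!inE] /orP[/eqP?|b1B] /orP[/eqP?|a1A]; subst; try lra.
by case: h => h; order_facts; lra.
Qed.

Lemma zone_RD_disj p B C : under C B \/ left_of C B ->
  separated (zone id p B) (zone antitransp p C).
Proof.
move=> h z; rewrite /zone /below_some /above_some /antitransp /=.
move=> [r1 _ _ [b1 + r4] r5] [u1 _ _ [a1 + u4] u5].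
case: u5 => [?|[a2 a2A u5]]; first lra.
case: r5 => [?|[b2 b2B r5]]; first lra.
move=> /[!inE] /orP[/eqP?|b1B] /orP[/eqP?|a1A]; subst; try lra.
by case: h => h; order_facts; lra.
Qed.

(* [t] can be drawn on [Q] with a free horizontal ray leaving the root to the
   left. *)
Definition ray Q t := t = Nil \/ exists r Z,
  [/\ r \in Q, draw Q t r Z, included Z (hull Q) &
      forall z, z.2 = r.2 -> z.1 <= r.1 -> ~ Z z].

Definition F_drawable k t := forall Q, gp Q -> (k <= size Q)%N -> ray Q t.

Definition G_drawable k t := forall p Q, gp (p :: Q) -> left_of [:: p] Q ->
  (k <= size Q)%N -> branch Q t p (zone id p Q).

Definition K_drawable k t := forall Q, gp Q -> (k <= size Q)%N ->
  exists r A, [/\ r \in Q, {subset A <= Q} & branch A t r (zone id r A)].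

Lemma branch_left Q t p Z r b Zr : r \in Q -> r != p -> draw Q t r Zr ->
  included Zr Z -> (forall z, edge p r b z -> z != p -> Z z /\ ~ Zr z) ->
  branch Q t p Z.
Proof. by move=> *; right; exists r, b, Zr. Qed.

Lemma branch_sub Q A t p Z :
  {subset A <= Q} -> branch A t p Z -> branch Q t p Z.
Proof. by move=> sA; apply: branch_mono. Qed.

Lemma ray_node Q v t1 t2 t3 r Z1 Z2 Z3 : r \in Q ->
  branch Q t1 r Z1 -> branch Q t2 r Z2 -> branch Q t3 r Z3 ->
  separated Z1 Z2 -> separated Z1 Z3 -> separated Z2 Z3 ->
  (forall z, Z1 z \/ Z2 z \/ Z3 z ->
    hull Q z /\ ~ (z.2 = r.2 /\ z.1 <= r.1)) ->
  ray Q (Node v t1 t2 t3).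
Proof.
move=> rQ b1 b2 b3 d12 d13 d23 h; right.
exists r, (fun z => Z1 z \/ Z2 z \/ Z3 z); split=> //.
- exists Z1, Z2, Z3; split=> //.
  + by split=> z; tauto.
  + by case/h=> _ [].
- by move=> z /h[].
- by move=> z z1 z2 /h[_ []].
Qed.

Lemma zoneP_U p A z : zone transp p A z -> p.2 < z.2. Proof. by case. Qed.
Lemma zoneP_R p A z : zone id p A z -> p.1 < z.1. Proof. by case. Qed.
Lemma zoneP_L p A z : zone flipX p A z -> z.1 < p.1.
Proof. by case=> /= *; lra. Qed.
Lemma zoneP_D p A z : zone antitransp p A z -> z.2 < p.2.
Proof. by case=> /= *; lra. Qed.

Lemma ray_URD Q v t1 t2 t3 r A B C :
  r \in Q -> {subset A <= Q} -> {subset B <= Q} -> {subset C <= Q} ->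
  branch A t1 r (zone transp r A) -> branch B t2 r (zone id r B) ->
  branch C t3 r (zone antitransp r C) ->
  under B A \/ left_of A B -> under C B \/ left_of C B ->
  ray Q (Node v t1 t2 t3).
Proof.
move=> rQ sA sB sC b1 b2 b3 hAB hCB.
apply: (ray_node v rQ (branch_sub sA b1) (branch_sub sB b2) (branch_sub sC b3)).
- exact: zone_UR_disj.
- by move=> z /zoneP_U ? /zoneP_D ?; lra.
- exact: zone_RD_disj.
move=> z [|[]] zz; split; try exact: zone_hull zz.
- by move: zz => /zoneP_U ? [? ?]; lra.
- by move: zz => /zoneP_R ? [? ?]; lra.
- by move: zz => /zoneP_D ? [? ?]; lra.
Qed.

(* The edge from [p] arrives at [r] from below, after a horizontal start. *)
Lemma branch_URL Q v t1 t2 t3 p r A B C :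
  r \in Q -> {subset A <= Q} -> {subset B <= Q} -> {subset C <= Q} ->
  left_of [:: p] Q -> p.2 < r.2 -> under [:: p] C ->
  branch A t1 r (zone transp r A) -> branch B t2 r (zone id r B) ->
  branch C t3 r (zone flipX r C) ->
  under B A \/ left_of A B -> under C A \/ left_of C A ->
  branch Q (Node v t1 t2 t3) p (zone id p Q).
Proof.
move=> rQ sA sB sC lQ pr pC b1 b2 b3 hAB hCA.
have pr1 : p.1 < r.1 by order_facts.
have hA z : zone transp r A z -> hull Q z by apply: zone_hull.
have hB z : zone id r B z -> hull Q z by apply: zone_hull.
have hC z : zone flipX r C z -> hull Q z by apply: zone_hull.
have hp z : hull Q z -> zone id p Q z by apply: hull_zone.
pose Zr z := zone transp r A z \/ zone id r B z \/ zone flipX r C z.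
apply: (@branch_left _ _ _ _ r false Zr) => //.
- by apply/eqP=> e; move: pr; rewrite e ltxx.
- exists (zone transp r A), (zone id r B), (zone flipX r C); split=> //.
  + by split=> z; rewrite /Zr; tauto.
  + split; [exact: zone_UR_disj | exact: zone_UL_disj | ].
    by move=> z /zoneP_R ? /zoneP_L ?; lra.
  + by move=> [/zoneP_U|[/zoneP_R|/zoneP_L]] ?; lra.
  + by split; [exact: branch_sub b1|exact: branch_sub b2|exact: branch_sub b3].
- by move=> z; rewrite /Zr => -[/hA|[/hB|/hC]] /hp.
move=> z; rewrite /edge /btw => ez zp.
have zrng : p.1 < z.1 <= r.1 /\ p.2 <= z.2 <= r.2.
  case: ez => [[e h]|[e h]]; last lra.
  have : z.1 != p.1 by apply: contraNneq zp => e';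
    case: z e e' h => ? ? /= -> ->; case: (p).
  by rewrite neq_lt => /orP[]?; lra.
split.
  split=> /=; first lra.
  - by exists r => //=; lra.
  - by exists r => /=; [rewrite inE rQ orbT | lra].
  - by exists p => /=; [rewrite mem_head | lra].
  - by case: ez => [[e h]|[e h]]; [left | right; exists r => //=; lra].
case=> [/zoneP_U ?|[/zoneP_R ?|zL]]; [lra|lra|].
have zr := zoneP_L zL; case: zL => _ _ _ [c + hc] _.
case: ez => [[e h]|[e h]]; last lra.
rewrite inE => /orP[/eqP ec|cC]; first by rewrite /= ec in hc; lra.
by rewrite /= in hc; order_facts; lra.
Qed.

End Drawable.

(** * Drawing strategies *)

#[local] Hint Resolve symmetry_id symmetry_flipX symmetry_flipY symmetry_transp
  symmetry_antitransp : core.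

Section Strategies.
Variables (R : realType) (V : Type).
Local Notation pt := (R * R)%type.
Implicit Types (p q r z : pt) (A B C L M Q W Mt Mm Mb : seq pt).
Implicit Types (t : tree V) (Z : pt -> Prop).

Lemma branch_zone_sym s Q t p s' : symmetry s ->
  branch (map s Q) t (s p) (zone s' (s p) (map s Q)) ->
  branch Q t p (zone (s' \o s) p Q).
Proof.
move=> sP /(branch_sym sP); apply: branch_mono => // z.
by rewrite zone_map.
Qed.

Lemma left_of_sub p A Q : {subset A <= Q} -> left_of [:: p] Q -> left_of [:: p] A.
Proof. by move=> sA h a b aA /sA; apply: h. Qed.

Lemma G_sym s k t p Q : G_drawable R k t -> symmetry s -> gp (p :: Q) ->
  (forall q, q \in Q -> (s p).1 < (s q).1) -> (k <= size Q)%N ->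
  branch Q t p (zone s p Q).
Proof.
move=> G sP g h kQ; apply: (branch_zone_sym (s' := id)) => //.
apply: G; rewrite ?size_map //; first exact: (gp_sym sP g).
move=> a b; rewrite inE => /eqP-> /mapP[q qQ ->]; exact: h.
Qed.

Lemma ray_sym s Q t : symmetry s -> basic_symmetry s -> ray (map s Q) t ->
  t = Nil \/ exists r Z, [/\ r \in Q, draw Q t r Z, included Z (hull Q) &
      forall z, (s z).2 = (s r).2 -> (s z).1 <= (s r).1 -> ~ Z z].
Proof.
move=> sP bs [->|[r [Z [rQ dr iZ nZ]]]]; first by left.
right; exists (s r), (fun z => Z (s z)); split.
- by rewrite -(mem_map_sym sP).
- by apply: draw_sym => //; rewrite symK.
- by move=> z /iZ; apply: hull_map.
- by move=> z; rewrite symK //; apply: nZ.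
Qed.

(** The edge goes down from [p], to the left of all the points, and then follows the free ray into
    the root. *)
Lemma F_corner k t p Q : F_drawable R k t -> gp Q -> (k <= size Q)%N ->
  left_of [:: p] Q -> under Q [:: p] -> branch Q t p (zone antitransp p Q).
Proof.
move=> F gQ kQ lQ uQ; have [->|[r [Z [rQ dr iZ nZ]]]] := F Q gQ kQ; first by left.
have [pr1 pr2] : p.1 < r.1 /\ r.2 < p.2 by order_facts; lra.
have zQ z : hull Q z -> zone antitransp p Q z.
  move=> [[a aQ h1] [b bQ h2] [c cQ h3] [d dQ h4]]; split=> /=.
  - by order_facts; lra.
  - by exists d => //=; lra.
  - by exists b => /=; [rewrite inE bQ orbT | lra].
  - by exists a => /=; [rewrite inE aQ orbT | lra].
  - by right; exists c => //=; lra.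
apply: (@branch_left _ _ _ _ _ _ r true Z) => //.
- by apply/eqP=> e; move: pr1; rewrite e ltxx.
- by move=> z /iZ /zQ.
move=> z; rewrite /edge /btw => ez zp; split.
  have zp2 : z.2 < p.2.
    case: ez => [[e h]|[e h]]; last lra.
    have : z.2 != p.2.
      by apply: contraNneq zp => e'; case: z e e' h => ? ? /= -> ->; case: (p).
    by rewrite neq_lt => /orP[]?; lra.
  split=> /=; first lra.
  - by exists r => //=; lra.
  - by exists p => /=; [rewrite mem_head|lra].
  - by exists r => /=; [rewrite inE rQ orbT|lra].
  - by case: ez => [[e h]|[e h]]; [left; lra|right; exists r => //=; lra].
case: ez => [[e h] /iZ[_ [b bQ hb] _ _]|[e h]]; first by order_facts; lra.
by apply: nZ => //; lra.
Qed.

Lemma F_sym s k t p Q : F_drawable R k t -> symmetry s -> gp Q ->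
  (k <= size Q)%N ->
  (forall q, q \in Q -> (s p).1 < (s q).1 /\ (s q).2 < (s p).2) ->
  branch Q t p (zone (antitransp \o s) p Q).
Proof.
move=> F sP gQ kQ h; apply: branch_zone_sym => //.
apply: F_corner F _ _ _ _; rewrite ?size_map //; first exact: gp_sym.
- by move=> a b; rewrite inE => /eqP-> /mapP[q /h[] ? ? ->].
- by move=> b a /mapP[q /h[] ? ? ->]; rewrite inE => /eqP->.
Qed.

(** After reflection in the antidiagonal the free ray points upwards: the edge runs to the right
    above all the points and drops onto the root. *)
Lemma F_right_under k t p Q : F_drawable R k t -> gp Q -> (k <= size Q)%N ->
  left_of [:: p] Q -> under Q [:: p] -> branch Q t p (zone id p Q).
Proof.
move=> F gQ kQ lQ uQ.
have b := F_sym F (symmetry_antitransp R) gQ kQ (p := p).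
apply: branch_mono (b _) => //.
- move=> z; apply: zone_eq => x; exact: symK.
- by move=> q qQ; order_facts; rewrite /=; lra.
Qed.

Lemma F_up_right k t p Q : F_drawable R k t -> gp Q -> (k <= size Q)%N ->
  left_of [:: p] Q -> under [:: p] Q -> branch Q t p (zone transp p Q).
Proof.
move=> F gQ kQ lQ uQ.
have b := F_sym F (symmetry_flipY R) gQ kQ (p := p).
apply: branch_mono (b _) => //.
- move=> z zz; apply/zone_flipY; apply: zone_eq zz => x.
  by rewrite /flipY /antitransp /transp /= opprK.
- by move=> q qQ; order_facts; rewrite /=; lra.
Qed.

Lemma F_nil k : F_drawable R k (@Nil V). Proof. by move=> *; left. Qed.
Lemma G_nil k : G_drawable R k (@Nil V). Proof. by move=> *; left. Qed.

Lemma K_nil k : (0 < k)%N -> K_drawable R k (@Nil V).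
Proof.
move=> k0 [|r Q] gQ /= kQ; first by lia.
by exists r, [::]; split; [rewrite mem_head | | left].
Qed.

Lemma K_of_G k t : G_drawable R k t -> K_drawable R k.+1 t.
Proof.
move=> G Q gQ kQ; have [|p [A [pQ sA gA szA lA]]] := leftmost gQ; first lia.
by exists p, A; split=> //; apply: G => //; lia.
Qed.

Lemma draw_swap12 Q v t1 t2 t3 r Z :
  draw Q (Node v t1 t2 t3) r Z -> draw Q (Node v t2 t1 t3) r Z.
Proof.
move=> [Z1 [Z2 [Z3 [[i1 i2 i3] [d12 d13 d23] nr [b1 b2 b3]]]]].
by exists Z2, Z1, Z3; split=> //; split=> // z h1 h2; apply: d12 h2 h1.
Qed.

Lemma draw_swap23 Q v t1 t2 t3 r Z :
  draw Q (Node v t1 t2 t3) r Z -> draw Q (Node v t1 t3 t2) r Z.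
Proof.
move=> [Z1 [Z2 [Z3 [[i1 i2 i3] [d12 d13 d23] nr [b1 b2 b3]]]]].
by exists Z1, Z3, Z2; split=> //; split=> // z h1 h2; apply: d23 h2 h1.
Qed.

Lemma ray_swap12 Q v t1 t2 t3 :
  ray Q (Node v t1 t2 t3) -> ray Q (Node v t2 t1 t3).
Proof.
move=> [//|[r [Z [rQ dr iZ nZ]]]]; right; exists r, Z; split=> //.
exact: draw_swap12.
Qed.

Lemma ray_swap23 Q v t1 t2 t3 :
  ray Q (Node v t1 t2 t3) -> ray Q (Node v t1 t3 t2).
Proof.
move=> [//|[r [Z [rQ dr iZ nZ]]]]; right; exists r, Z; split=> //.
exact: draw_swap23.
Qed.

Lemma branch_swap12 Q v t1 t2 t3 p Z :
  branch Q (Node v t1 t2 t3) p Z -> branch Q (Node v t2 t1 t3) p Z.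
Proof.
move=> [//|[q [b [Z' [qQ qp dr iZ eZ]]]]]; right; exists q, b, Z'; split=> //.
exact: draw_swap12.
Qed.

Lemma branch_swap23 Q v t1 t2 t3 p Z :
  branch Q (Node v t1 t2 t3) p Z -> branch Q (Node v t1 t3 t2) p Z.
Proof.
move=> [//|[q [b [Z' [qQ qp dr iZ eZ]]]]]; right; exists q, b, Z'; split=> //.
exact: draw_swap23.
Qed.

Lemma F_split3 v t1 t2 t3 k1 k2 k3 :
  G_drawable R k1 t1 -> G_drawable R k2 t2 -> G_drawable R k3 t3 ->
  F_drawable R (k1 + k2 + k3).+1 (Node v t1 t2 t3).
Proof.
move=> G1 G2 G3 Q gQ kQ.
have [|C [Q1 [[gC gQ1 sC sQ1] szC szQ1 uC]]] := @split_bottom _ Q k3 gQ; first lia.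
have [|B [A [[gB gA sB sA] szB szA uA]]] := @split_top _ Q1 k1 gQ1; first lia.
have [|p [B' [pB sB' gB' szB' lB']]] := leftmost gB; first lia.
have pQ1 := sB _ pB.
have uCp : under C [:: p] by move=> a b aC; rewrite inE => /eqP->; exact: uC.
have uAp : under [:: p] A by move=> a b; rewrite inE => /eqP->; exact: uA.
have uBA : under B' A by move=> a b /sB'; apply: uA.
have uCB : under C B' by move=> a b aC /sB' /sB; apply: uC.
apply: (@ray_URD _ _ _ _ _ _ _ p A B' C); first exact: sQ1.
- by move=> x /sA /sQ1.
- by move=> x /sB' /sB /sQ1.
- exact: sC.
- apply: G_sym G1 _ _ _ _ => //.
    by apply: gp_cons gQ1 _ _ _ (under_notin uAp).
  by move=> q qA; exact: uAp (mem_head _ _) qA.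
- by apply: G2 => //; lia.
- apply: G_sym G3 _ _ _ _ => //.
    apply: gp_cons gQ _ _ _ _ => //; first exact: sQ1.
    by apply/negP=> /uCp/(_ (mem_head _ _)); rewrite ltxx.
  by move=> q qC; rewrite /= ltrN2; exact: uCp qC (mem_head _ _).
- by left.
- by left.
Qed.

Lemma size_filter_split (a b : pred pt) Q :
  (forall q, q \in Q -> ~~ a q -> b q) ->
  (size Q <= size (filter a Q) + size (filter b Q))%N.
Proof.
elim: Q => //= q Q IH h.
have : (size Q <= size (filter a Q) + size (filter b Q))%N.
  by apply: IH => x xQ; apply: h; rewrite inE xQ orbT.
by have := h q (mem_head _ _); case: (a q); case: (b q) => //= h'; 
  first [lia | by have := h' isT].
Qed.

(** The points of [L] above the root [r1] of the drawing of [t1] are of two kinds. If more than [k3]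
    of them lie below all of [Mt], the new root is one of these; its edge down turns onto the ray of
    [r1], and [t2] goes to [Mt]. Otherwise the new root can be chosen above all of [Mm]; [t1] is
    entered from above and [t2] goes to [Mb]. In both cases the other points of that kind carry
    [t3]. *)
Lemma F_beside_half v t1 t2 t3 k1 k2 k3 Q L Mt Mm Mb r1 Z1 :
  F_drawable R k1 t1 -> F_drawable R k2 t2 -> G_drawable R k3 t3 ->
  gp Q -> {subset L <= Q} -> {subset Mt <= Q} -> {subset Mm <= Q} ->
  {subset Mb <= Q} -> gp L -> gp Mt -> gp Mm -> gp Mb ->
  left_of L Mt -> left_of L Mm -> left_of L Mb -> under Mm Mt -> under Mb Mm ->
  (k2 <= size Mt)%N -> (k1 <= size Mm)%N -> (k2 <= size Mb)%N ->
  r1 \in Mm -> draw Mm t1 r1 Z1 -> included Z1 (hull Mm) ->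
  (forall z, z.2 = r1.2 -> z.1 <= r1.1 -> ~ Z1 z) ->
  (2 * k3 < size [seq q : pt <- L | (r1.2 < q.2)%R])%N ->
  ray Q (Node v t1 t2 t3).
Proof.
move=> F1 F2 G3 gQ sL sMt sMm sMb gL gMt gMm gMb lt lm lb umt ubm kt km kb
  r1M dr iZ nZ.
set W := filter _ L => szW.
have sW : {subset W <= L} by move=> x; rewrite mem_filter => /andP[].
have aW q : q \in W -> r1.2 < q.2 by rewrite mem_filter => /andP[].
have gW : gp W by apply: gp_filter.
pose U1 := [seq q : pt <- W | all (fun m : pt => q.2 < m.2) Mt].
pose U2 := [seq q : pt <- W | ~~ all (fun m : pt => q.2 < m.2) Mt].
have szU : (size W <= size U1 + size U2)%N by apply: size_filter_split.
have [U1k|U1k] := ltnP k3 (size U1).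
  have gU1 : gp U1 by apply: gp_filter.
  have [|p [U [pU1 sU gU szU' lU]]] := leftmost gU1; first lia.
  have U1W : {subset U1 <= W} by move=> x; rewrite mem_filter => /andP[].
  have pL := sW _ (U1W _ pU1).
  have sUL : {subset U <= L} by move=> x /sU /U1W /sW.
  have U1t : under U1 Mt.
    by move=> a b; rewrite mem_filter => /andP[/allP h _] /h.
  have ut : under [:: p] Mt.
    by move=> a b; rewrite inE => /eqP-> /(U1t p _ pU1).
  have uUt : under U Mt by move=> a b /sU; apply: U1t.
  have lp A : left_of L A -> left_of [:: p] A.
    by move=> h a b; rewrite inE => /eqP->; apply: h.
  have pr1 := lm _ _ pL r1M.
  have pr2 := aW _ (U1W _ pU1).
  have pQ := sL _ pL.
  (* The drawing of [t1] is already fixed, since the height of its ray was needed to choose [p]. Its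
     region is therefore assembled by hand: the two pieces of the edge and the bounding box of
     [Mm]. *)
  pose Zc z := [\/ z.1 = p.1 /\ r1.2 <= z.2 < p.2,
    z.2 = r1.2 /\ p.1 <= z.1 <= r1.1 | hull Mm z].
  have pM z : hull Mm z -> p.1 < z.1.
    by case=> _ [b bM h] _ _; have := lm _ _ pL bM; lra.
  have b1 : branch Q t1 p Zc.
    apply: (@branch_left _ _ _ _ _ _ r1 true Z1); first exact: sMm.
    - by apply/eqP=> e; move: pr1; rewrite e ltxx.
    - exact: draw_mono dr.
    - by move=> z /iZ h; apply: Or33.
    move=> z; rewrite /edge /btw => ez zp; split.
      case: ez => [[e h]|[e h]]; last by apply: Or32; lra.
      have : z.2 != p.2.
        by apply: contraNneq zp => e'; case: z e e' h => ? ? /= -> ->; case: (p).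
      by rewrite neq_lt => /orP[]?; [apply: Or31|exfalso]; lra.
    case: ez => [[e h] /iZ /pM|[e h]]; first lra.
    by apply: nZ => //; lra.
  apply: (ray_node v pQ b1 (branch_sub sMt (F_up_right F2 gMt kt (lp _ lt) ut))
    (Z3 := zone id p U)).
  - apply: (@branch_sub _ _ Q U) => [x /sUL /sL //|].
    by apply: G3 => //; lia.
  - move=> z hc [/= u1 _ _ _ u5]; case: hc => [|| hz]; try lra.
    have := pM _ hz; case: u5 => [|[m mM u5]]; first lra.
    by case: hz => _ _ [c cM hc] _; move: u5 => /=; order_facts; lra.
  - move=> z hc [/= u1 [u uU u2] _ [w + u4] _].
    rewrite inE => wU; have : r1.2 < w.2.
      by case/orP: wU => [/eqP->//|/sU /U1W /aW].
    case: hc => [|| [_ [b bM hb] _ _]]; try by move: u4 => /=; lra.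
    by have := lm _ _ (sUL _ uU) bM; move: u2 => /=; lra.
  - by apply: zone_UR_disj; left.
  move=> z [hc|[zz|zz]]; split; try by [apply: zone_hull zz|
    apply: zone_hull zz => // x /sUL /sL].
  - have r1Q := sMm _ r1M.
    case: hc => [hc|hc|]; last exact: hull_mono.
    + by split; [exists p|exists p|exists p|exists r1] => //; lra.
    + by split; [exists r1|exists p|exists r1|exists r1] => //; lra.
  - by case: hc => [||/pM]; lra.
  - by move: zz => /zoneP_U; lra.
  - by move: zz => /zoneP_R; lra.
have gU2 : gp U2 by apply: gp_filter.
have [|p [U [pU2 sU gU szU' lU]]] := lowest gU2; first lia.
have U2W : {subset U2 <= W} by move=> x; rewrite mem_filter => /andP[].
have pL := sW _ (U2W _ pU2).
have sUL : {subset U <= L} by move=> x /sU /U2W /sW.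
(* A point of [U2] is at least as high as some point of [Mt], hence above all of [Mm]. *)
have um : under Mm [:: p].
  move=> c b cM; rewrite inE => /eqP->; move: pU2.
  rewrite mem_filter => /andP[/allPn[m mM]]; rewrite -leNgt => h _.
  by order_facts; lra.
have lp A : left_of L A -> left_of [:: p] A.
  by move=> h a b; rewrite inE => /eqP->; apply: h.
apply: ray_swap23; apply: ray_swap12.
have umU : under Mm U by move=> c u cM uU; order_facts; lra.
have ubp : under Mb [:: p].
  by move=> b x bM; rewrite inE => /eqP->; order_facts; lra.
apply: (@ray_URD _ _ _ _ _ _ _ p U Mm Mb) => //.
- exact: sL.
- by move=> x /sUL /sL.
- apply: G_sym G3 _ _ _ _ => //; last lia.
  by move=> q qU; order_facts.
(* [t1] is drawn anew in [Mm] with its ray pointing up; here the drawing rooted at [r1] has only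
   served to define [W]. *)
- exact: F_right_under F1 gMm km (lp _ lm) um.
- exact: F_corner F2 gMb kb (lp _ lb) ubp.
- by left.
- by left.
Qed.

Lemma left_of_map_flipY A B : left_of A B -> left_of (map flipY A) (map flipY B).
Proof. by move=> h x y /mapP[a aA ->] /mapP[b bB ->]; exact: (h a b). Qed.

Lemma under_map_flipY A B : under A B -> under (map flipY B) (map flipY A).
Proof.
by move=> h x y /mapP[a aA ->] /mapP[b bB ->]; rewrite /= ltrN2; exact: (h b a).
Qed.

Lemma sub_map_flipY A Q : {subset A <= Q} -> {subset map flipY A <= map flipY Q}.
Proof. by move=> h x /mapP[a aA ->]; apply: map_f; apply: h. Qed.

Lemma ray_flipY Q t : ray (map flipY Q) t -> ray Q t.
Proof.
move=> h; case: (ray_sym (symmetry_flipY R) (basic_flipY R) h) => [->|[r [Z [rQ dr iZ nZ]]]]; first by left.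
right; exists r, Z; split=> // z e le_z; apply: nZ => //.
by rewrite /= e.
Qed.

Lemma branch_flipY Q t p :
  branch (map flipY Q) t (flipY p) (zone id (flipY p) (map flipY Q)) ->
  branch Q t p (zone id p Q).
Proof.
move=> /(branch_zone_sym (symmetry_flipY R)); apply: branch_mono => // z.
by move/zone_flipY.
Qed.

Lemma filter_map_flipY (a : R) A :
  [seq q : pt <- map flipY A | - a < q.2] =
  map flipY [seq q : pt <- A | q.2 < a].
Proof.
by rewrite filter_map; congr map; apply: eq_filter => q; rewrite /= ltrN2.
Qed.

Lemma size_above_below (a : R) A : (forall q, q \in A -> a != q.2) ->
  (size A <= size [seq q : pt <- A | (a < q.2)%R] +
             size [seq q : pt <- A | (q.2 < a)%R])%N.
Proof.
move=> h; apply: size_filter_split => q /h; rewrite -leNgt le_eqVlt eq_sym.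
by move=> /negPf-> /=.
Qed.

(** The strip is halved twice: by the height of [r1], and by the two cases of [F_beside_half]. Its
    [4 * k3 + 1] points thus leave [k3 + 1], the root and the points for [t3]. The case is not known
    in advance, so [k2] points are reserved both above and below. *)
Lemma F_beside v t1 t2 t3 k1 k2 k3 : t1 <> Nil ->
  F_drawable R k1 t1 -> F_drawable R k2 t2 -> G_drawable R k3 t3 ->
  F_drawable R (k1 + 2 * k2 + 4 * k3).+1 (Node v t1 t2 t3).
Proof.
move=> t1N F1 F2 G3 Q gQ kQ.
have [|L [Q1 [[gL gQ1 sL sQ1] szL szQ1 lLQ]]] :=
  @split_left _ Q (4 * k3).+1 gQ; first lia.
have [|Q2 [Mt [[gQ2 gMt sQ2 sMt] szQ2 szMt uMt]]] :=
  @split_top _ Q1 k2 gQ1; first lia.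
have [|Mb [Mm [[gMb gMm sMb sMm] szMb szMm uMb]]] :=
  @split_bottom _ Q2 k2 gQ2; first lia.
have szM : (k1 <= size Mm)%N by lia.
have [//|[r1 [Z1 [r1M dr iZ nZ]]]] := F1 Mm gMm szM.
have sMmQ1 : {subset Mm <= Q1} by move=> x /sMm /sQ2.
have sMbQ1 : {subset Mb <= Q1} by move=> x /sMb /sQ2.
have sMmQ : {subset Mm <= Q} by move=> x /sMmQ1 /sQ1.
have sMbQ : {subset Mb <= Q} by move=> x /sMbQ1 /sQ1.
have sMtQ : {subset Mt <= Q} by move=> x /sMt /sQ1.
have lt : left_of L Mt by move=> a b aL /sMt; apply: lLQ.
have lm : left_of L Mm by move=> a b aL /sMmQ1; apply: lLQ.
have lb : left_of L Mb by move=> a b aL /sMbQ1; apply: lLQ.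
have umt : under Mm Mt by move=> a b /sMm; apply: uMt.
have nr q : q \in L -> r1.2 != q.2.
  move=> qL; have [|_ //] := gp_neq gQ (sMmQ _ r1M) (sL _ qL).
  by apply/eqP=> e; have := lm _ _ qL r1M; rewrite e ltxx.
have := size_above_below nr.
have [up|up dn] := ltnP (2 * k3)%N (size [seq q : pt <- L | (r1.2 < q.2)%R]).
  by move=> _; apply: F_beside_half F1 F2 G3 gQ sL sMtQ sMmQ sMbQ gL gMt gMm gMb
    lt lm lb umt uMb szMt szM szMb r1M dr iZ nZ up.
have g A : gp A -> gp (map flipY A) by apply: gp_sym; apply: symmetry_flipY.
apply: ray_flipY.
apply: (@F_beside_half v t1 t2 t3 k1 k2 k3 _ (map flipY L) (map flipY Mb)
  (map flipY Mm) (map flipY Mt) (flipY r1) (fun z => Z1 (flipY z)) F1 F2 G3);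
  rewrite ?size_map; do ?[exact: g|exact: sub_map_flipY|exact: left_of_map_flipY
   |exact: under_map_flipY|done].
- exact: map_f.
- apply: (draw_sym (symmetry_flipY R)).
  by rewrite (map_symK (symmetry_flipY R)) (symK (symmetry_flipY R)).
- move=> z /iZ h; apply: (hull_map (s := flipY)) => //.
  by rewrite (map_symK (symmetry_flipY R)).
- by move=> z /= e h; apply: nZ => //=; rewrite e opprK.
- by rewrite filter_map_flipY size_map; lia.
Qed.

Lemma K_sym s k t Q : K_drawable R k t -> symmetry s -> gp Q ->
  (k <= size Q)%N ->
  exists r A, [/\ r \in Q, {subset A <= Q} & branch A t r (zone s r A)].
Proof.
move=> K sP gQ kQ; have [||r [A [rQ sA b]]] := K (map s Q).
- exact: gp_sym.
- by rewrite size_map.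
exists (s r), (map s A); split; first by rewrite -(mem_map_sym sP).
  by move=> x; rewrite (mem_map_sym sP) => /sA; rewrite (mem_map_sym sP) symK.
by apply: (branch_zone_sym (s' := id)) => //; rewrite map_symK // symK.
Qed.

(** The root is whatever point [r] a (K)-drawing of [t2], reflected so as to extend to the left,
    provides. Type (G) works from any such [r], upwards for [t3] and to the right for [t1]. The edge
    from [p] passes below [W] and enters [r] from below. *)
Lemma G_half v t1 t2 t3 k1 k2 k3 p Q W B :
  G_drawable R k1 t1 -> K_drawable R k2 t2 -> G_drawable R k3 t3 ->
  gp Q -> left_of [:: p] Q -> gp W -> gp B -> {subset W <= Q} ->
  {subset B <= Q} -> left_of W B -> under [:: p] W ->
  (k1 <= size B)%N -> (k2 + k3 <= size W)%N ->
  branch Q (Node v t1 t2 t3) p (zone id p Q).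
Proof.
move=> G1 K2 G3 gQ lQ gW gB sW sB lWB uW szB szW.
have [|L [A [[gL gA sL sA] szL szA uLA]]] := @split_top _ W k3 gW; first lia.
have [|r [C [rL sC bC]]] := K_sym K2 (symmetry_flipX R) gL; first lia.
have rW := sL _ rL; have rQ := sW _ rW.
have lrB : left_of [:: r] B.
  by move=> a b; rewrite inE => /eqP->; apply: lWB.
have urA : under [:: r] A.
  by move=> a b; rewrite inE => /eqP->; apply: uLA.
apply: branch_swap23; apply: branch_swap12.
apply: (@branch_URL _ _ _ _ _ _ _ p r A B C) => //.
- by move=> x /sA /sW.
- by move=> x /sC /sL /sW.
- by order_facts.
- by move=> a b aP /sC /sL; apply: uW.
- apply: G_sym G3 _ _ _ _ => //.
    by apply: gp_cons gW rW gA sA (under_notin urA).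
  by move=> q qA; order_facts.
- by apply: G1 => //; apply: gp_cons gQ rQ gB sB (left_of_notin lrB).
- by right=> a b /sA; apply: lWB.
- by left=> a b /sC; apply: uLA.
Qed.

(** Among [2 * (k2 + k3) - 1] points, [k2 + k3] are on the same side of the height of [p]. *)
Lemma G_step v t1 t2 t3 k1 k2 k3 :
  G_drawable R k1 t1 -> K_drawable R k2 t2 -> G_drawable R k3 t3 ->
  G_drawable R (k1 + (2 * (k2 + k3)).-1) (Node v t1 t2 t3).
Proof.
move=> G1 K2 G3 p Q gpQ lQ kQ; have gQ := gp_tail gpQ.
have [|W [B [[gW gB sW sB] szW szB lWB]]] := @split_right _ Q k1 gQ; first lia.
have qpQ q : q \in Q -> q \in p :: Q by rewrite inE => ->; rewrite orbT.
have nW q : q \in W -> p.2 != q.2.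
  move=> /sW qQ; have [|_ //] := gp_neq gpQ (mem_head _ _) (qpQ q qQ).
  by apply: contraTneq qQ => <-; apply: left_of_notin.
have := size_above_below nW.
set Wa := filter _ W; set Wb := filter _ W => sz.
have [up|dn] : (k2 + k3 <= size Wa \/ k2 + k3 <= size Wb)%N by lia.
  apply: (@G_half v t1 t2 t3 k1 k2 k3 p Q Wa B) G1 K2 G3 gQ lQ _ gB _ sB _ _ szB up.
  - exact: gp_filter.
  - by move=> x; rewrite mem_filter => /andP[_ /sW].
  - by move=> a b; rewrite mem_filter => /andP[_ aW]; apply: lWB.
  - by move=> a b; rewrite inE mem_filter => /eqP-> /andP[].
apply: branch_flipY.
have g A : gp A -> gp (map flipY A) by apply: gp_sym; apply: symmetry_flipY.
apply: (@G_half v t1 t2 t3 k1 k2 k3 _ _ (map flipY Wb) (map flipY B)) G1 K2 G3 _ _ _ _ _ _ _ _ _ _;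
  rewrite ?size_map //; do ?[exact: g|exact: sub_map_flipY].
- by move=> a b; rewrite inE => /eqP-> /mapP[q qQ ->]; exact: lQ (mem_head _ _) qQ.
- by apply/g/gp_filter.
- by apply: sub_map_flipY => x; rewrite mem_filter => /andP[_ /sW].
- apply: left_of_map_flipY => a b; rewrite mem_filter => /andP[_ aW].
  exact: lWB.
- move=> a b; rewrite inE => /eqP-> /mapP[q + ->].
  by rewrite mem_filter /= ltrN2 => /andP[].
Qed.

End Strategies.

(** * Spines *)

Section Spine.
Variables (R : realType) (V : Type).
Local Notation pt := (R * R)%type.
Implicit Types (p q r z : pt) (A B C Q L M W T S X Y : seq pt).
Implicit Types (t : tree V) (Z : pt -> Prop).

(* The points available for the rest of a spine that has reached [p] and is to
   be continued to the right: [W] is a vertical strip next to [p], and [T] and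
   [S] are horizontal strips above and below everything else. *)
Definition spine_config p W M T S Q : Prop :=
  [/\ gp (p :: Q), left_of [:: p] Q,
      [/\ {subset W <= Q}, {subset M <= Q}, {subset T <= Q} & {subset S <= Q}],
      [/\ gp W, gp M, gp T & gp S] &
      [/\ [/\ left_of W M, left_of W T & left_of W S],
          [/\ under [:: p] T, under W T & under M T] &
          [/\ under S [:: p], under S W & under S M]]].

(** Both horizontal strips must offer [a] points, because whether a step of the spine hangs a
    subtree above or below depends on the positions of the points in [W]. [N] is the total demand,
    which may be met by any of the strips. *)
Definition spine_drawable t (a w N : nat) : Prop :=
  forall p W M T S Q, spine_config p W M T S Q ->
  (w <= size W)%N -> (a <= size T)%N -> (a <= size S)%N ->
  (N <= size W + size M + size T + size S)%N -> branch Q t p (zone id p Q).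

Lemma disjoint_gp_cat Q A B : gp Q -> gp A -> gp B -> {subset A <= Q} ->
  {subset B <= Q} -> (forall x, x \in A -> x \in B -> False) -> gp (A ++ B).
Proof.
move=> gQ gA gB sA sB d; apply: gp_sub gQ.
  rewrite cat_uniq !gp_uniq // andbT; apply/hasPn => x xB; apply/negP=> xA.
  exact: d xA xB.
by move=> x; rewrite mem_cat => /orP[/sA|/sB].
Qed.

Lemma gp_spine p W M T S Q :
  spine_config p W M T S Q -> gp (W ++ (M ++ (T ++ S))).
Proof.
case=> /gp_tail gQ lQ [sW sM sT sS] [gW gM gT gS]
  [[lWM lWT lWS] [upT uWT uMT] [uSp uSW uSM]].
have gTS : gp (T ++ S).
  by apply: disjoint_gp_cat gQ _ _ sT sS _ => // x xT xS; order_facts; lra.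
have sTS : {subset T ++ S <= Q}.
  by move=> x; rewrite mem_cat => /orP[/sT|/sS].
have gMTS : gp (M ++ (T ++ S)).
  apply: disjoint_gp_cat gQ _ _ sM sTS _ => // x xM.
  by rewrite mem_cat => /orP[] xX; order_facts; lra.
have sMTS : {subset M ++ (T ++ S) <= Q}.
  by move=> x; rewrite mem_cat => /orP[/sM|/sTS].
apply: disjoint_gp_cat gQ _ _ sW sMTS _ => // x xW.
by rewrite !mem_cat => /or3P[] xX; order_facts; lra.
Qed.

Lemma spine_config_flipY p W M T S Q : spine_config p W M T S Q ->
  spine_config (flipY p) (map flipY W) (map flipY M) (map flipY S)
    (map flipY T) (map flipY Q).
Proof.
have g A : gp A -> gp (map flipY A) by apply: gp_sym; apply: symmetry_flipY.
have l := @left_of_map_flipY R; have u := @under_map_flipY R.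
have s := @sub_map_flipY R.
case=> gQ lQ [sW sM sT sS] [gW gM gT gS]
  [[lWM lWT lWS] [upT uWT uMT] [uSp uSW uSM]].
split; first exact: (g (p :: Q)).
- exact: (l [:: p]).
- by split; apply: s.
- by split; apply: g.
- split; first by split; apply: l.
  + by split; [exact: (u _ [:: p])|exact: u|exact: u].
  + by split; [exact: (u [:: p])|exact: u|exact: u].
Qed.

(** When the spine ends the strips lose their roles, and their disjoint union is a single point set
    to the right of [p]. *)
Lemma G_spine t k a w : G_drawable R k t -> spine_drawable t a w k.
Proof.
move=> G p W M T S Q c _ _ _ kN; have gA := gp_spine c.
case: c => gQ lQ [sW sM sT sS] _ _.
have sA : {subset W ++ (M ++ (T ++ S)) <= Q}.
  by move=> x; rewrite !mem_cat => /or4P[/sW|/sM|/sT|/sS].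
apply: branch_mono (G p _ _ (left_of_sub sA lQ) _) => //.
- by move=> z; apply: zone_mono.
- apply: gp_cons gQ (mem_head _ _) gA _ (left_of_notin (left_of_sub sA lQ)).
  by move=> x /sA; rewrite inE => ->; rewrite orbT.
- by rewrite !size_cat; lia.
Qed.

(** The root is the rightmost point of [L], so the rest of [L] is available to its left port for
    [t3]. [t2] takes the highest points of [T]; everything kept for the continuation is then below
    them, and the up and right ports do not interfere. *)
Lemma spine_half v t1 t2 t3 k2 k3 a w N p W M T S Q L W' :
  spine_drawable t1 a w N -> F_drawable R k2 t2 -> G_drawable R k3 t3 ->
  spine_config p W M T S Q -> gp L -> {subset L <= W} -> under [:: p] L ->
  gp W' -> {subset W' <= W} -> left_of L W' -> (k3 < size L)%N ->
  (w <= size W')%N -> (a + k2 <= size T)%N -> (a <= size S)%N ->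
  (N + k2 <= size W' + size M + size T + size S)%N ->
  branch Q (Node v t1 t2 t3) p (zone id p Q).
Proof.
move=> sp1 F2 G3 [gpQ lQ [sW sM sT sS] [gW gM gT gS]
  [[lWM lWT lWS] [upT uWT uMT] [uSp uSW uSM]]] gL sL upL gW' sW' lLW'
  szL szW' szT szS szN.
have gQ := gp_tail gpQ.
have [|r [C [rL sC gC szC lC]]] := rightmost gL; first lia.
have [|T' [A [[gT' gA sT' sA] szT' szA uTA]]] := @split_top _ T k2 gT; first lia.
have rW := sL _ rL; have rQ := sW _ rW.
have pr : p.2 < r.2 by order_facts.
have lr B : left_of W B -> left_of [:: r] B.
  by move=> h x y; rewrite inE => /eqP->; apply: h.
have lrA : left_of [:: r] A by apply: lr => x y xW /sA; apply: lWT.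
have urA : under [:: r] A.
  by move=> x y; rewrite inE => /eqP-> /sA; apply: uWT.
pose B := W' ++ (M ++ (T' ++ S)).
have memB x : x \in B -> [\/ x \in W', x \in M, x \in T' | x \in S].
  by rewrite !mem_cat => /or4P.
have sB : {subset B <= Q}.
  by move=> x /memB[/sW' /sW|/sM|/sT' /sT|/sS].
have lrB : left_of [:: r] B.
  move=> x y; rewrite inE => /eqP-> /memB[yY|yY|/sT' yY|yY]; order_facts => //.
have sCW : {subset C <= W} by move=> x /sC /sL.
have uAB : under B A.
  move=> x y /memB[/sW' xX|xX|xX|xX] yA; have := sA _ yA => yT; order_facts => //.
  by lra.
have c0 : spine_config r W' M T' S B.
  have sub x : x \in W' \/ x \in M \/ x \in T' \/ x \in S -> x \in B.
    by rewrite !mem_cat; case=> [|[|[]]] ->; rewrite ?orbT.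
  have gB : gp B.
    apply: (@gp_spine p W' M T' S Q); split=> //.
      by split=> //; [move=> x /sW' /sW|move=> x /sT' /sT].
    split.
    - by split; [move=> x y /sW' + yY; exact: (fun h => lWM _ _ h yY)
        |move=> x y /sW' + /sT'; apply: lWT|move=> x y /sW'; apply: lWS].
    - by split; [move=> x y xp /sT'; apply: upT
        |move=> x y /sW' + /sT'; apply: uWT|move=> x y + /sT'; apply: uMT].
    - by split=> // x y xS /sW'; apply: uSW.
  split=> //.
  - exact: gp_cons gQ rQ gB sB (left_of_notin lrB).
  - by split=> x xX; apply: sub; tauto.
  - split.
    + by split; [move=> x y /sW' + yY; exact: (fun h => lWM _ _ h yY)
        |move=> x y /sW' + /sT'; apply: lWT|move=> x y /sW'; apply: lWS].
    + by split; [move=> x y; rewrite inE => /eqP-> /sT'; apply: uWT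
        |move=> x y /sW' + /sT'; apply: uWT|move=> x y + /sT'; apply: uMT].
    + by split; [move=> x y xS; rewrite inE => /eqP->; apply: uSW
        |move=> x y xS /sW'; apply: uSW|].
apply: branch_swap12.
apply: (@branch_URL _ _ _ _ _ _ _ p r A B C) => //.
- by move=> x /sA /sT.
- by move=> x /sCW /sW.
- by move=> x y xp /sC; apply: upL.
- exact: F_up_right F2 gA szA lrA urA.
- by apply: sp1 c0 _ _ _ _ => //; lia.
- apply: G_sym G3 _ gC _ _ => //; last lia.
  by move=> q qC; rewrite /= ltrN2; apply: lC => //; rewrite mem_head.
- by left.
- by left=> x y /sCW xW /sA; apply: uWT.
Qed.

Lemma spine_step v t1 t2 t3 k2 k3 a w N :
  spine_drawable t1 a w N -> F_drawable R k2 t2 -> G_drawable R k3 t3 ->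
  spine_drawable (Node v t1 t2 t3) (a + k2) (w + (2 * k3).+1)
    (N + k2 + (2 * k3).+1).
Proof.
move=> sp1 F2 G3 p W M T S Q c szW szT szS szN.
have [gpQ lQ [sW _ _ _] [gW _ _ _] [[lWM lWT lWS] _ _]] := c.
have [|L [W' [[gL gW' sL sW'] szL szW' lLW']]] :=
  @split_left _ W (2 * k3).+1 gW; first lia.
have memQ q : q \in Q -> q \in p :: Q by rewrite inE => ->; rewrite orbT.
have nL q : q \in L -> p.2 != q.2.
  move=> /sL /sW qQ.
  have [|_ //] := gp_neq gpQ (mem_head _ _) (memQ q qQ).
  by apply: contraTneq qQ => <-; apply: left_of_notin.
have := size_above_below nL.
set La := filter _ L; set Lb := filter _ L => sz.
have [up|dn] : (k3 < size La \/ k3 < size Lb)%N by lia.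
  apply: (@spine_half v t1 t2 t3 k2 k3 a w N p W M T S Q La W' sp1 F2 G3 c) => //;
    try lia.
  - exact: gp_filter.
  - by move=> x; rewrite mem_filter => /andP[_ /sL].
  - by move=> x y; rewrite inE mem_filter => /eqP-> /andP[].
  - by move=> x y; rewrite mem_filter => /andP[_ xL]; apply: lLW'.
apply: branch_flipY.
have g A : gp A -> gp (map flipY A) by apply: gp_sym; apply: symmetry_flipY.
apply: (@spine_half v t1 t2 t3 k2 k3 a w N _ _ _ _ _ _ (map flipY Lb)
  (map flipY W') sp1 F2 G3 (spine_config_flipY c)); rewrite ?size_map //;
  try lia; do ?[exact: g|exact: sub_map_flipY].
- by apply/g/gp_filter.
- by apply: sub_map_flipY => x; rewrite mem_filter => /andP[_ /sL].
- move=> x y; rewrite inE => /eqP-> /mapP[q + ->].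
  by rewrite mem_filter /= ltrN2 => /andP[].
- by apply: left_of_map_flipY => x y; rewrite mem_filter => /andP[_ xL]; apply: lLW'.
Qed.

Lemma F_right_above k t p Q : F_drawable R k t -> gp Q -> (k <= size Q)%N ->
  left_of [:: p] Q -> under [:: p] Q -> branch Q t p (zone id p Q).
Proof.
move=> F gQ kQ lQ uQ; apply: branch_flipY.
apply: F_right_under F _ _ _ _; rewrite ?size_map //.
- by apply: gp_sym => //; apply: symmetry_flipY.
- exact: (@left_of_map_flipY R [:: p]).
- exact: (@under_map_flipY R [:: p]).
Qed.

Lemma K_of_spine t k kF a w N : spine_drawable t a w N -> F_drawable R kF t ->
  (w < k)%N -> (w + a + kF <= k)%N -> (N < k)%N -> K_drawable R k t.
Proof.
move=> sp F wk ak Nk Q gQ kQ.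
have [|X [Y [[gX gY sX sY] szX szY lXY]]] := @split_left _ Q w.+1 gQ; first lia.
pose above (q : pt) := all (fun x : pt => x.2 < q.2) X.
pose below (q : pt) := all (fun x : pt => q.2 < x.2) X.
pose T := [seq q : pt <- Y | above q].
pose S := [seq q : pt <- Y | below q].
have fsub (f : pred pt) : {subset filter f Y <= Y}.
  by move=> x; rewrite mem_filter => /andP[].
have lX x A : x \in X -> {subset A <= Y} -> left_of [:: x] A.
  by move=> xX sA y z; rewrite inE => /eqP-> /sA; apply: lXY.
(* With fewer than [a] points in [T], the others, at least [k - w - a], are below and to the right
   of the highest point of [X]. *)
have [szT|szT] := ltnP (size T) a.
  have [|p pX hp] := @exists_max R snd X; first lia.
  pose A := [seq q : pt <- Y | ~~ above q].
  have szA : (size Y <= size T + size A)%N by apply: size_filter_split.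
  exists p, A; split; [exact: sX| by move=> x /fsub /sY|].
  apply: F_right_under F _ _ (lX _ _ pX (@fsub _)) _; first exact: gp_filter.
    by rewrite -/A; lia.
  move=> x y xA; rewrite inE => /eqP->; move: xA.
  rewrite mem_filter => /andP[/allPn[z zX]]; rewrite -leNgt => xz xY.
  have [|_ xp] := gp_neq gQ (sY _ xY) (sX _ pX).
    by apply/eqP=> xp; have := lXY _ _ pX xY; rewrite xp ltxx.
  by rewrite lt_neqAle xp; apply: le_trans xz (hp _ zX).
have [szS|szS] := ltnP (size S) a.
  have [|p pX hp] := @exists_max R (fun q => - q.2) X; first lia.
  pose A := [seq q : pt <- Y | ~~ below q].
  have szA : (size Y <= size S + size A)%N by apply: size_filter_split.
  exists p, A; split; [exact: sX| by move=> x /fsub /sY|].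
  apply: F_right_above F _ _ (lX _ _ pX (@fsub _)) _; first exact: gp_filter.
    by rewrite -/A; lia.
  move=> y x; rewrite inE => /eqP-> xA; move: xA.
  rewrite mem_filter => /andP[/allPn[z zX]]; rewrite -leNgt => xz xY.
  have [|_ xp] := gp_neq gQ (sX _ pX) (sY _ xY).
    by apply/eqP=> xp; have := lXY _ _ pX xY; rewrite xp ltxx.
  rewrite lt_neqAle xp; apply: le_trans xz.
  by have := hp _ zX; rewrite lerN2.
(* One point of [X] becomes the parent point; this accounts for [w.+1] and for the strict inequality
   [N < k]. *)
have [|p [W [pX sW gpW szW lW]]] := leftmost gX; first lia.
have gW := gp_tail gpW.
pose M := [seq q : pt <- Y | ~~ above q && ~~ below q].
have szM : (size Y <= size M + size T + size S)%N.
  rewrite /M /T /S; elim: (Y) => //= q Z IH.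
  by case: (above q); case: (below q) => /=; lia.
have lWY : left_of W Y by move=> x y /sW; apply: lXY.
have gWY : gp (W ++ Y).
  apply: disjoint_gp_cat gQ gW gY _ sY _ => [x /sW /sX //|x xW xY].
  by order_facts; lra.
have sWY : {subset W ++ Y <= Q}.
  by move=> x; rewrite mem_cat => /orP[/sW /sX|/sY].
have lp : left_of [:: p] (W ++ Y).
  move=> x y; rewrite inE mem_cat => /eqP-> /orP[yW|].
    by apply: lW => //; apply: mem_head.
  exact: lXY.
exists p, (W ++ Y); split; [exact: sX|exact: sWY|].
have XT : under X T.
  by move=> x y xX; rewrite mem_filter => /andP[/allP h _]; apply: h.
have SX : under S X.
  by move=> y x; rewrite mem_filter => /andP[/allP h _] xX; apply: h.
apply: (sp p W M T S (W ++ Y)) => //; try lia.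
split=> //.
- exact: gp_cons gQ (sX _ pX) gWY sWY (left_of_notin lp).
- by split=> x; rewrite mem_cat => h; apply/orP; [left|right..]; move: h => // /fsub.
- by split=> //; apply: gp_filter.
- split.
  + by split=> x y xW /fsub; apply: lWY.
  + split; [|by move=> x y /sW; apply: XT|].
      by move=> x y; rewrite inE => /eqP->; apply: XT.
    move=> x y; rewrite mem_filter => /andP[/andP[/allPn[z zX xz] _] _] yT.
    by rewrite -leNgt in xz; apply: le_lt_trans xz (XT _ _ zX yT).
  + split; [|by move=> x y xS /sW; apply: SX|].
      by move=> x y xS; rewrite inE => /eqP->; apply: SX.
    move=> x y xS; rewrite mem_filter => /andP[/andP[_ /allPn[z zX yz]] _].
    by rewrite -leNgt in yz; apply: lt_le_trans (SX _ _ xS zX) yz.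
Qed.

End Spine.

(** * Inequalities *)

(* Locked, so that [lra] does not compare its values up to conversion. *)
HB.lock Definition pw (R : realType) (x : R) : R := x `^ (31 / 20).

Section Power.
Variable R : realType.
Implicit Types (x y z s t b c : R).

Local Notation pw := (@pw R).

Lemma pwE x : pw x = x `^ (31 / 20). Proof. by rewrite unlock. Qed.

Lemma pw_ge0 x : 0 <= pw x. Proof. by rewrite pwE powR_ge0. Qed.

Lemma pw0 : pw 0 = 0.
Proof. by rewrite pwE powR0 //; apply/eqP; lra. Qed.

Lemma pw1 : pw 1 = 1. Proof. by rewrite pwE powR1. Qed.

Lemma pw_mono x y : 0 <= x -> x <= y -> pw x <= pw y.
Proof. by move=> x0 xy; rewrite !pwE; apply: ge0_ler_powR; rewrite ?nnegrE //; lra. Qed.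

Lemma pwM x y : 0 <= x -> 0 <= y -> pw (x * y) = pw x * pw y.
Proof. by rewrite !pwE; apply: powRM. Qed.

(** Turns rational bounds on powers of rationals into inequalities between integer powers, which are
    settled by computation. *)
Lemma pw_exp20 x : 0 <= x -> pw x ^+ 20 = x ^+ 31.
Proof.
move=> x0; rewrite -!powR_mulrn ?pw_ge0 // pwE -powRrM; congr (_ `^ _); lra.
Qed.

Lemma pw_le x c : 0 <= x -> 0 <= c -> x ^+ 31 <= c ^+ 20 -> pw x <= c.
Proof.
by move=> x0 c0; rewrite -pw_exp20 // ler_pXn2r // nnegrE ?pw_ge0.
Qed.

Lemma pw_ge x c : 0 <= x -> 0 <= c -> c ^+ 20 <= x ^+ 31 -> c <= pw x.
Proof.
by move=> x0 c0; rewrite -pw_exp20 // ler_pXn2r // nnegrE ?pw_ge0.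
Qed.

Lemma pw_jensen t x y : 0 <= t <= 1 -> 0 <= x -> 0 <= y ->
  pw (t * x + (1 - t) * y) <= t * pw x + (1 - t) * pw y.
Proof.
move=> /andP[t0 t1] x0 y0.
have p1 : 1 <= 31 / 20 :> R by lra.
rewrite !pwE; have h := @hoelder.convex_powR R _ p1 (interval_inference.Itv01 t0 t1) x y.
have := h (classical_sets.mem_set _) (classical_sets.mem_set _).
by rewrite /= !in_itv /= x0 y0 => /(_ isT isT); rewrite !convex.convRE.
Qed.

Lemma ratio01 x y : 0 <= x <= y -> 0 < y -> 0 <= x / y <= 1.
Proof.
by case/andP=> x0 xy y0; rewrite divr_ge0 ?(ltW y0) //= ler_pdivrMr // mul1r.
Qed.

Lemma pw_jensen3 (l1 l2 l3 a b c : R) : 0 <= l1 -> 0 <= l2 -> 0 <= l3 ->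
  l1 + l2 + l3 = 1 -> 0 <= a -> 0 <= b -> 0 <= c ->
  pw (l1 * a + l2 * b + l3 * c) <= l1 * pw a + l2 * pw b + l3 * pw c.
Proof.
move=> l10 l20 l30 sl a0 b0 c0.
have [l1E|l1N] := eqVneq l1 1.
  have -> : l2 = 0 by lra.
  have -> : l3 = 0 by lra.
  by rewrite l1E !mul1r !mul0r !addr0.
have d0 : 0 < 1 - l1 by move: l1N; rewrite neq_lt => /orP[] ?; lra.
have h1 := @pw_jensen (l2 / (1 - l1)) b c.
have h2 := @pw_jensen l1 a (l2 / (1 - l1) * b + (1 - l2 / (1 - l1)) * c).
have q0 : 0 <= l2 / (1 - l1) <= 1.
  by apply: ratio01 => //; lra.
have e1 x y : (1 - l1) * (l2 / (1 - l1) * x + (1 - l2 / (1 - l1)) * y) =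
    l2 * x + l3 * y.
  have -> : l3 = 1 - l1 - l2 by lra.
  by field; lra.
have {}h1 := h1 q0 b0 c0.
have m0 : 0 <= l2 / (1 - l1) * b + (1 - l2 / (1 - l1)) * c.
  case/andP: q0 => q0 q1; apply: addr_ge0; apply: mulr_ge0 => //.
  by rewrite subr_ge0.
have {}h2 := h2 _ a0 m0.
rewrite e1 addrA in h2; apply: le_trans (h2 _) _; first by lra.
rewrite -[leRHS]addrA lerD2l -e1; apply: ler_wpM2l h1; lra.
Qed.

(** [a + h] and [b] are convex combinations of [a] and [b + h] with exchanged weights; the two
    convexity inequalities add up to the claim. *)
Lemma pw_increment (a b h : R) : 0 <= a -> a <= b -> 0 <= h ->
  pw (a + h) + pw b <= pw a + pw (b + h).
Proof.
move=> a0 ab h0.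
have [hb|hb] := eqVneq (b + h - a) 0.
  have -> : h = 0 by lra.
  have -> : b = a by lra.
  by rewrite addr0.
have L0 : 0 < b + h - a by rewrite lt_neqAle eq_sym hb /=; lra.
have t01 : 0 <= h / (b + h - a) <= 1.
  by apply: ratio01 => //; lra.
have h1 := @pw_jensen _ (b + h) a t01.
have h2 := @pw_jensen _ a (b + h) t01.
have e1 : h / (b + h - a) * (b + h) + (1 - h / (b + h - a)) * a = a + h.
  by field.
have e2 : h / (b + h - a) * a + (1 - h / (b + h - a)) * (b + h) = b.
  by field.
rewrite e1 in h1; rewrite e2 in h2.
have {}h1 := h1 ltac:(lra) a0; have {}h2 := h2 a0 ltac:(lra).
lra.
Qed.

Lemma pw_superadd x y : 0 <= x -> 0 <= y -> pw x + pw y <= pw (x + y).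
Proof.
move=> x0 y0; have := @pw_increment 0 x y (lexx 0) x0 y0.
rewrite pw0 add0r; lra.
Qed.

Lemma pw_scale s x : 0 < s -> 0 <= x -> pw x = pw s * pw (x / s).
Proof.
move=> s0 x0; rewrite -pwM ?divr_ge0 //; try lra.
by congr pw; field; lra.
Qed.

(** As [pw] vanishes at 0, convexity keeps its graph over the interval from 0 to [b] below any line
    through the origin that is above it at [b]. *)
Lemma pw_chord0 b c y : 0 < b -> 0 <= y <= b -> pw b <= c * b -> pw y <= c * y.
Proof.
move=> b0 yb pb; have t01 : 0 <= y / b <= 1.
  by apply: ratio01 => //; lra.
have := @pw_jensen (y / b) b 0 t01 ltac:(lra) (lexx 0).
rewrite pw0 !mulr0 !addr0 mulfVK; last lra.
move=> h; apply: le_trans h _; rewrite mulrAC ler_pdivrMr //.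
have y0 : 0 <= y by lra.
by have := ler_wpM2l y0 pb; lra.
Qed.

End Power.

Ltac pw_num := apply: pw_le; lra.

Section Inequalities.
Variable R : realType.
Implicit Types (x y z s t c u v w : R).

Local Notation pw := (@pw R).

Lemma pw_half : pw (1/2) <= 13/38. Proof. by pw_num. Qed.
Lemma pw_third : pw (1/3) <= 11/60. Proof. by pw_num. Qed.
Lemma pw_0535 : pw (107/200) <= 11/29. Proof. by pw_num. Qed.
Lemma pw_0465 : pw (93/200) <= 11/36. Proof. by pw_num. Qed.
Lemma pw_07 : pw (7/10) <= 19/33. Proof. by pw_num. Qed.
Lemma pw_015 : pw (3/20) <= 3/56. Proof. by pw_num. Qed.
Lemma pw_06 : pw (3/5) <= 5/11. Proof. by pw_num. Qed.
Lemma pw_095 : pw (19/20) <= 49/53. Proof. by pw_num. Qed.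
Lemma pw_005 : pw (1/20) <= 1/103. Proof. by pw_num. Qed.
Lemma pw_04 : pw (2/5) <= 8/33. Proof. by pw_num. Qed.
Lemma pw_007 : pw (7/100) <= 1/60. Proof. by pw_num. Qed.
Lemma pw_086 : pw (43/50) <= 19/24. Proof. by pw_num. Qed.

(* A weighted sum of powers is convex, so on a triangle it is at most its
   largest value at a vertex. *)
Lemma pw_triangle (m k1 k2 k3 l1 l2 l3 a1 b1 c1 a2 b2 c2 a3 b3 c3 u v w : R) :
  0 <= k1 -> 0 <= k2 -> 0 <= k3 ->
  0 <= l1 -> 0 <= l2 -> 0 <= l3 -> l1 + l2 + l3 = 1 ->
  [/\ 0 <= a1, 0 <= b1 & 0 <= c1] -> [/\ 0 <= a2, 0 <= b2 & 0 <= c2] ->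
  [/\ 0 <= a3, 0 <= b3 & 0 <= c3] ->
  u = l1 * a1 + l2 * a2 + l3 * a3 -> v = l1 * b1 + l2 * b2 + l3 * b3 ->
  w = l1 * c1 + l2 * c2 + l3 * c3 ->
  k1 * pw a1 + k2 * pw b1 + k3 * pw c1 <= m ->
  k1 * pw a2 + k2 * pw b2 + k3 * pw c2 <= m ->
  k1 * pw a3 + k2 * pw b3 + k3 * pw c3 <= m ->
  k1 * pw u + k2 * pw v + k3 * pw w <= m.
Proof.
move=> k10 k20 k30 l10 l20 l30 sl [a10 b10 c10] [a20 b20 c20] [a30 b30 c30]
  -> -> -> h1 h2 h3.
have A := ler_wpM2l k10 (pw_jensen3 l10 l20 l30 sl a10 a20 a30).
have B := ler_wpM2l k20 (pw_jensen3 l10 l20 l30 sl b10 b20 b30).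
have C := ler_wpM2l k30 (pw_jensen3 l10 l20 l30 sl c10 c20 c30).
have H1 := ler_wpM2l l10 h1; have H2 := ler_wpM2l l20 h2.
have H3 := ler_wpM2l l30 h3.
have M : m = l1 * m + l2 * m + l3 * m by rewrite -!mulrDl sl mul1r.
lra.
Qed.

(** Values of [pw] are generalized together with their rational bounds, so that [lra] treats them as
    atoms. *)
Ltac vertex_bound :=
  clear;
  repeat match goal with
  | |- context [pw 0] => generalize (@pw0 R); generalize (pw 0)
  | |- context [pw 1] => generalize (@pw1 R); generalize (pw 1)
  | |- context [pw (1/2)] => generalize pw_half; generalize (pw (1/2))
  | |- context [pw (1/3)] => generalize pw_third; generalize (pw (1/3))
  | |- context [pw (107/200)] => generalize pw_0535; generalize (pw (107/200))
  | |- context [pw (93/200)] => generalize pw_0465; generalize (pw (93/200))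
  | |- context [pw (7/10)] => generalize pw_07; generalize (pw (7/10))
  | |- context [pw (3/20)] => generalize pw_015; generalize (pw (3/20))
  | |- context [pw (3/5)] => generalize pw_06; generalize (pw (3/5))
  | |- context [pw (19/20)] => generalize pw_095; generalize (pw (19/20))
  | |- context [pw (1/20)] => generalize pw_005; generalize (pw (1/20))
  | |- context [pw (2/5)] => generalize pw_04; generalize (pw (2/5))
  | |- context [pw (7/100)] => generalize pw_007; generalize (pw (7/100))
  | |- context [pw (43/50)] => generalize pw_086; generalize (pw (43/50))
  end;
  intros; lra.

Ltac vertex :=
  lazymatch goal with
  | |- is_true _ => vertex_bound
  | |- _ => split; lra
  end.

(** 36/25 is 2.88 / 2. The line [u = 107/200 + 11/10 * w] joins (107/200, 93/200, 0) to (7/10, 3/20,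
    3/20), two points at which this recurrence and the one of [beside_unit] both hold with little to
    spare; it divides the ordered simplex between the two. *)
Lemma split3_unit u v w : u + v + w = 1 -> 0 <= w -> w <= v -> v <= u ->
  u <= 107/200 + 11/10 * w ->
  36/25 * pw u + 36/25 * pw v + 36/25 * pw w <= 1.
Proof.
move=> e w0 wv vu hu.
(* the diagonal from (1/2, 1/2, 0) to (7/10, 3/20, 3/20) splits the region *)
have [d|d] := lerP (4/3 * w) (u - 1/2).
- apply: (@pw_triangle 1 _ _ _ (1 - (u - 1/2 - 4/3 * w) * 200/7 - w * 20/3)
    ((u - 1/2 - 4/3 * w) * 200/7) (w * 20/3)
    (1/2) (1/2) 0 (107/200) (93/200) 0 (7/10) (3/20) (3/20)); try lra; vertex.
- apply: (@pw_triangle 1 _ _ _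
  (1 - (4/3 * w - u + 1/2) * 18/11 - (w - (4/3 * w - u + 1/2) * 6/11) * 20/3)
  ((4/3 * w - u + 1/2) * 18/11) ((w - (4/3 * w - u + 1/2) * 6/11) * 20/3)
  (1/2) (1/2) 0 (1/3) (1/3) (1/3) (7/10) (3/20) (3/20)); try lra; vertex.
Qed.

(** The coefficients are the costs 2, 2 * 2 and 4 * 2.88 of the three subtrees, divided by 2. The
    weights in the proof are barycentric coordinates. *)
Lemma beside_unit u v w : u + v + w = 1 -> 0 <= w -> w <= v ->
  107/200 + 11/10 * w <= u ->
  1 * pw u + 2 * pw v + 144/25 * pw w <= 1.
Proof.
move=> e w0 wv hu.
apply: (@pw_triangle 1 _ _ _ (1 - (v - w) * 200/93 - w * 20/3)
    ((v - w) * 200/93) (w * 20/3)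
    1 0 0 (107/200) (93/200) 0 (7/10) (3/20) (3/20)); try lra; vertex.
Qed.

(** 23/12 is 2 * 2.76 / 2.88. At the critical vertex (1/2, 1/2, 0) the sum exceeds 0.99, and this is
    what limits the constant of (K). *)
Lemma G_unit u v w : u + v + w = 1 -> 0 <= w -> w <= v -> v <= u ->
  1 * pw u + 23/12 * pw v + 2 * pw w <= 1.
Proof.
move=> e w0 wv vu.
apply: (@pw_triangle 1 _ _ _ (u - v) (2 * (v - w)) (3 * w)
    1 0 0 (1/2) (1/2) 0 (1/3) (1/3) (1/3)); try lra; vertex.
Qed.

(** 23/24 is 2.76 / 2.88. Here the middle subtree is charged at the rate of (G); the lower bound on
    [w] keeps away from (1/2, 1/2, 0), where the sum exceeds 1. *)
Lemma even_unit u v w : u + v + w = 1 -> 7/100 <= w -> w <= v -> v <= u ->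
  1 * pw u + 2 * pw v + 2 * pw w <= 23/24.
Proof.
move=> e w0 wv vu.
apply: (@pw_triangle (23/24) _ _ _ (1 - (v - w) * 200/79 - (w - 7/100) * 300/79)
    ((v - w) * 200/79) ((w - 7/100) * 300/79)
    (43/50) (7/100) (7/100) (93/200) (93/200) (7/100) (1/3) (1/3) (1/3)); try lra; vertex.
Qed.

Lemma lopsided_unit u : 3/5 <= u <= 19/20 -> pw u + 2 * pw (1 - u) <= 23/24.
Proof.
move=> h; pose l := (u - 3/5) * 20/7.
(* A dummy third term and a vertex of weight 0 reduce the triangle to a segment. *)
suff : 1 * pw u + 2 * pw (1 - u) + 0 * pw 0 <= 23/24 by lra.
apply: (@pw_triangle (23/24) _ _ _ (1 - l) l 0
   (3/5) (2/5) 0 (19/20) (1/20) 0 0 0 0); rewrite /l; try lra; vertex.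
Qed.

End Inequalities.

(** * The recurrences for arbitrary sizes, by scaling *)

Section Homogeneous.
Variable R : realType.
Implicit Types (x y z s e M k m : R).
Local Notation pw := (@pw R).

Lemma pw_homog k1 k2 k3 m s x y z : 0 < s -> 0 <= x -> 0 <= y -> 0 <= z ->
  k1 * pw (x / s) + k2 * pw (y / s) + k3 * pw (z / s) <= m ->
  k1 * pw x + k2 * pw y + k3 * pw z <= m * pw s.
Proof.
move=> s0 x0 y0 z0 h.
rewrite (pw_scale s0 x0) (pw_scale s0 y0) (pw_scale s0 z0).
have := ler_wpM2r (pw_ge0 s) h; lra.
Qed.

Lemma split3_le x y z : 0 <= z -> z <= y -> y <= x ->
  x <= 107/200 * (x + y + z) + 11/10 * z ->
  36/25 * pw x + 36/25 * pw y + 36/25 * pw z <= pw (x + y + z).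
Proof.
move=> z0 zy yx h; have [s0|s0] := lerP (x + y + z) 0.
  have [-> -> ->] : [/\ x = 0, y = 0 & z = 0] by split; lra.
  by rewrite !addr0 pw0; lra.
have i0 : 0 <= (x + y + z)^-1 by rewrite invr_ge0 ltW.
have i1 : (x + y + z) * (x + y + z)^-1 = 1 by rewrite mulfV // gt_eqF.
rewrite -[leRHS]mul1r; apply: pw_homog => //; try lra.
have h1 := ler_wpM2r i0 z0; have h2 := ler_wpM2r i0 zy.
have h3 := ler_wpM2r i0 yx; have h4 := ler_wpM2r i0 h.
move: (x + y + z)^-1 i0 i1 h1 h2 h3 h4 => i i0 i1 h1 h2 h3 h4.
by apply: split3_unit; lra.
Qed.

Lemma beside_le x y z : 0 <= z -> z <= y -> y <= x ->
  107/200 * (x + y + z) + 11/10 * z <= x ->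
  1 * pw x + 2 * pw y + 144/25 * pw z <= pw (x + y + z).
Proof.
move=> z0 zy yx h; have [s0|s0] := lerP (x + y + z) 0.
  have [-> -> ->] : [/\ x = 0, y = 0 & z = 0] by split; lra.
  by rewrite !addr0 pw0; lra.
have i0 : 0 <= (x + y + z)^-1 by rewrite invr_ge0 ltW.
have i1 : (x + y + z) * (x + y + z)^-1 = 1 by rewrite mulfV // gt_eqF.
rewrite -[leRHS]mul1r; apply: pw_homog => //; try lra.
have h1 := ler_wpM2r i0 z0; have h2 := ler_wpM2r i0 zy.
have h4 := ler_wpM2r i0 h.
move: (x + y + z)^-1 i0 i1 h1 h2 h4 => i i0 i1 h1 h2 h4.
by apply: beside_unit; lra.
Qed.

Lemma G_le x y z : 0 <= z -> z <= y -> y <= x ->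
  1 * pw x + 23/12 * pw y + 2 * pw z <= pw (x + y + z).
Proof.
move=> z0 zy yx; have [s0|s0] := lerP (x + y + z) 0.
  have [-> -> ->] : [/\ x = 0, y = 0 & z = 0] by split; lra.
  by rewrite !addr0 pw0; lra.
have i0 : 0 <= (x + y + z)^-1 by rewrite invr_ge0 ltW.
have i1 : (x + y + z) * (x + y + z)^-1 = 1 by rewrite mulfV // gt_eqF.
rewrite -[leRHS]mul1r; apply: pw_homog => //; try lra.
have h1 := ler_wpM2r i0 z0; have h2 := ler_wpM2r i0 zy.
have h3 := ler_wpM2r i0 yx.
move: (x + y + z)^-1 i0 i1 h1 h2 h3 => i i0 i1 h1 h2 h3.
by apply: G_unit; lra.
Qed.

(** Superadditivity merges [y], [z] and [e] into the single amount [M - x]. *)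
Lemma lopsided_le M x y z e : 0 <= y -> 0 <= z -> 0 <= e -> 0 < M ->
  x + y + z + e <= M -> 3/5 * M <= x -> x <= 19/20 * M ->
  pw x + 2 * pw y + 2 * pw z + 2 * pw e <= 23/24 * pw M.
Proof.
move=> y0 z0 e0 M0 h h1 h2.
have s1 := pw_superadd y0 z0; have s2 := pw_superadd (addr_ge0 y0 z0) e0.
have s3 : pw (y + z + e) <= pw (M - x) by apply: pw_mono; lra.
suff : 1 * pw x + 2 * pw (M - x) + 0 * pw 0 <= 23/24 * pw M by lra.
apply: pw_homog => //; try lra.
have i0 : 0 <= M^-1 by rewrite invr_ge0 ltW.
have i1 : M * M^-1 = 1 by rewrite mulfV // gt_eqF.
rewrite mulrBl i1 mul0r addr0 mul1r; apply: lopsided_unit.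
have g1 := ler_wpM2r i0 h1; have g2 := ler_wpM2r i0 h2.
move: (M^-1) i0 i1 g1 g2 => i i0 i1 g1 g2; lra.
Qed.

(** Increments grow, and from [2 * e] to [3 * e] the increment is already 3^1.55 - 2^1.55 >= 2 times
    [pw e]. *)
Lemma pw_absorb x e : 0 <= e -> 2 * e <= x -> pw x + 2 * pw e <= pw (x + e).
Proof.
move=> e0 ex; have := @pw_increment R (2 * e) x e ltac:(lra) ex e0.
have -> : 2 * e + e = 3 * e by lra.
rewrite !pwM //.
have p3 : 5 <= pw 3 by apply: pw_ge; lra.
have p2 : pw 2 <= 3 by apply: pw_le; lra.
have g3 := ler_wpM2r (pw_ge0 e) p3; have g2 := ler_wpM2r (pw_ge0 e) p2.
have := pw_ge0 e; lra.
Qed.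

Lemma even_le M x y z e : 0 <= e -> 0 < M -> x + y + z + e <= M ->
  7/100 * M <= z -> z <= y -> y <= x -> 2 * e <= x ->
  pw x + 2 * pw y + 2 * pw z + 2 * pw e <= 23/24 * pw M.
Proof.
move=> e0 M0 h hz zy yx ex.
have s1 := pw_absorb e0 ex.
have s2 : pw (x + e) <= pw (M - y - z) by apply: pw_mono; lra.
suff : 1 * pw (M - y - z) + 2 * pw y + 2 * pw z <= 23/24 * pw M by lra.
apply: pw_homog => //; try lra.
have i0 : 0 <= M^-1 by rewrite invr_ge0 ltW.
have i1 : M * M^-1 = 1 by rewrite mulfV // gt_eqF.
have h1 := ler_wpM2r i0 hz; have h2 := ler_wpM2r i0 zy.
have h3 := ler_wpM2r i0 yx; have h4 := ler_wpM2r i0 h.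
have h5 := ler_wpM2r i0 e0.
move: (M^-1) i0 i1 h1 h2 h3 h4 h5 => i i0 i1 h1 h2 h3 h4 h5.
by apply: even_unit; lra.
Qed.

Lemma pw_chord_scale M b c y : 0 < M -> 0 < b -> 0 <= y -> y <= b * M ->
  pw b <= c * b -> pw y <= c * (y * (M^-1 * pw M)).
Proof.
move=> M0 b0 y0 yb pb; rewrite 2!mulrA -[c * y / M]mulrA (pw_scale M0 y0) mulrC ler_wpM2r ?pw_ge0 //.
apply: (pw_chord0 b0) => //.
by rewrite divr_ge0 ?(ltW M0) //= ler_pdivrMr.
Qed.

(** Each power is replaced by its chord from the origin to the largest value its argument can take,
    after which the claims are linear. 19/25 is 69/25 - 2, what (K) leaves for strips once (F) is
    paid for; 144/25 is 2 * 72/25. *)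
Lemma balanced_le M x y z e : 0 <= y -> 0 <= z -> 0 <= e -> 0 < M ->
  x + y + z + e <= M -> y <= x -> x <= 3/5 * M -> z <= 7/100 * M ->
  e <= 1/20 * M ->
  2 * pw y + 144/25 * pw z + 144/25 * pw e <= 19/25 * pw M /\
  72/25 * pw x + 2 * pw y + 144/25 * pw z + 144/25 * pw e <= 69/25 * pw M.
Proof.
move=> y0 z0 e0 M0 h yx hx hz he.
have hy : y <= 1/2 * M by lra.
have [b6 b5 b7 b0] : [/\ 0 < 3/5 :> R, 0 < 1/2 :> R, 0 < 7/100 :> R &
    0 < 1/20 :> R] by split; lra.
have x0 : 0 <= x by lra.
have c6 : pw (3/5) <= 25/33 * (3/5) by apply: le_trans (@pw_06 R) _; lra.
have c5 : pw (1/2) <= 13/19 * (1/2) by apply: le_trans (@pw_half R) _; lra.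
have c7 : pw (7/100) <= 5/21 * (7/100).
  by apply: le_trans (@pw_007 R) _; lra.
have c0 : pw (1/20) <= 20/103 * (1/20) by apply: le_trans (@pw_005 R) _; lra.
have cx := pw_chord_scale M0 b6 x0 hx c6.
have cy := pw_chord_scale M0 b5 y0 hy c5.
have cz := pw_chord_scale M0 b7 z0 hz c7.
have ce := pw_chord_scale M0 b0 e0 he c0.
have q0 : 0 <= M^-1 * pw M by rewrite mulr_ge0 ?pw_ge0 // invr_ge0 ltW.
have qM : M * (M^-1 * pw M) = pw M by rewrite mulVKf // gt_eqF.
move: (M^-1 * pw M) q0 qM cx cy cz ce => q q0 qM cx cy cz ce.
have h1 := ler_wpM2r q0 h; have h2 := ler_wpM2r q0 yx.
have h3 := ler_wpM2r q0 hx.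
have h4 := ler_wpM2r q0 hz; have h5 := ler_wpM2r q0 he.
have h6 := mulr_ge0 y0 q0; have h7 := mulr_ge0 z0 q0.
have h8 := mulr_ge0 e0 q0; have p0 := pw_ge0 M.
rewrite -[3/5 * M * q]mulrA qM in h3; rewrite -[7/100 * M * q]mulrA qM in h4.
rewrite -[1/20 * M * q]mulrA qM in h5; rewrite !mulrDl qM in h1.
move: (pw x) (pw y) (pw z) (pw e) (pw M) (x * q) (y * q) (z * q) (e * q)
  cx cy cz ce h1 h2 h3 h4 h5 h6 h7 h8 p0.
by clear=> *; split; lra.
Qed.

Lemma pw_small M e : 0 < M -> 0 <= e -> e <= 1/20 * M ->
  pw e <= 1/103 * pw M.
Proof.
move=> M0 e0 h; apply: le_trans (pw_mono e0 h) _.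
by rewrite pwM ?ler_wpM2r ?pw_ge0 ?pw_005 //; lra.
Qed.

End Homogeneous.

(** * The recursion *)

Fixpoint tsize (V : Type) (t : tree V) : nat :=
  if t is Node _ t1 t2 t3 then (tsize t1 + tsize t2 + tsize t3).+1 else 0.

Lemma wlog_sorted (T : Type) (sz : T -> nat) (P : T -> T -> T -> Prop) :
  (forall a b c, P a b c -> P b a c) -> (forall a b c, P a b c -> P a c b) ->
  (forall a b c, (sz c <= sz b)%N -> (sz b <= sz a)%N -> P a b c) ->
  forall a b c, P a b c.
Proof.
move=> s12 s23 H a b c.
have [ab|/ltnW ab] := leqP (sz a) (sz b); have [bc|/ltnW bc] := leqP (sz b) (sz c);
  have [ac|/ltnW ac] := leqP (sz a) (sz c).
- exact: s12 (s23 _ _ _ (s12 _ _ _ (H _ _ _ ab bc))).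
- exact: s12 (s23 _ _ _ (s12 _ _ _ (H _ _ _ ab bc))).
- exact: s12 (s23 _ _ _ (H _ _ _ ac bc)).
- exact: s12 (H _ _ _ ac ab).
- exact: s23 (s12 _ _ _ (H _ _ _ ab ac)).
- exact: s23 (H _ _ _ bc ac).
- exact: H.
- exact: H.
Qed.

(** This count and the following ones are rewritten as plain sums, so that [natrD] alone makes them
    linear over the reals. *)
Lemma beside_count a b d : (a + 2 * b + 4 * d = a + (b + b) + (d + d + (d + d)))%N.
Proof. lia. Qed.

Lemma G_count a b d : (a + (2 * (b.+1 + d)).-1 = a + (b + b) + (d + d) + 1)%N.
Proof. lia. Qed.

Lemma G_count2 a b d : (a + (2 * (b.+2 + d)).-1 = a + (b + b) + (d + d) + 3)%N.
Proof. lia. Qed.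

Lemma spine_count a w b d :
  (a + b + (w + (2 * d).+1) = (a + w) + b + (d + d) + 1)%N.
Proof. lia. Qed.

Lemma spine_total N b d : (N + b + (2 * d).+1 = N + b + (d + d) + 1)%N.
Proof. lia. Qed.

Section Induction.
Variables (R : realType) (V : Type).
Implicit Types (t : tree V) (n k m E : nat) (c : R).
Local Notation pw := (@pw R).
Local Notation F_drawable := (@F_drawable R V).
Local Notation G_drawable := (@G_drawable R V).
Local Notation K_drawable := (@K_drawable R V).
Local Notation spine_drawable := (@spine_drawable R V).

(** Rounding down is harmless: numbers of points are integers, so a bound by the real cost is a
    bound by its floor. *)
Definition cost c n : nat := Num.truncn (c * pw n%:R).

Lemma cost_le c n : 0 <= c -> (cost c n)%:R <= c * pw n%:R.
Proof. by move=> c0; rewrite truncn_le mulr_ge0 ?pw_ge0. Qed.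

Lemma le_cost k c n : 0 <= c -> k%:R <= c * pw n%:R -> (k <= cost c n)%N.
Proof. by move=> c0; rewrite truncn_ge_nat // mulr_ge0 ?pw_ge0. Qed.

Definition good t : Prop :=
  [/\ F_drawable (cost 2 (tsize t)) t, G_drawable (cost (72/25) (tsize t)) t &
      K_drawable (cost (69/25) (tsize t)).+2 t].

(** A heavy path can descend through all levels, so the induction has to carry [good] for every
    descendant. *)
Fixpoint all_good t : Prop :=
  good t /\ (if t is Node _ t1 t2 t3 then
    [/\ all_good t1, all_good t2 & all_good t3] else True).

Lemma all_good_good t : all_good t -> good t. Proof. by case: t => [|????] []. Qed.

Lemma F_mono k k' t : (k <= k')%N -> F_drawable k t -> F_drawable k' t.
Proof. by move=> kk F Q gQ kQ; apply: F => //; apply: leq_trans kQ. Qed.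

Lemma G_mono k k' t : (k <= k')%N -> G_drawable k t -> G_drawable k' t.
Proof. by move=> kk G p Q gQ lQ kQ; apply: G => //; apply: leq_trans kQ. Qed.

Lemma good_swap12 v (a b c : tree V) : good (Node v a b c) -> good (Node v b a c).
Proof.
case=> F G K; rewrite /good /= [(tsize b + _)%N]addnC; split.
- by move=> Q gQ kQ; apply: ray_swap12; apply: F.
- by move=> p Q gQ lQ kQ; apply: branch_swap12; apply: G.
- move=> Q gQ kQ; have [r [A [rQ sA h]]] := K Q gQ kQ; exists r, A; split=> //.
  exact: branch_swap12.
Qed.

Lemma good_swap23 v (a b c : tree V) : good (Node v a b c) -> good (Node v a c b).
Proof.
case=> F G K; rewrite /good /= addnAC; split.
- by move=> Q gQ kQ; apply: ray_swap23; apply: F.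
- by move=> p Q gQ lQ kQ; apply: branch_swap23; apply: G.
- move=> Q gQ kQ; have [r [A [rQ sA h]]] := K Q gQ kQ; exists r, A; split=> //.
  exact: branch_swap23.
Qed.

Lemma F_node v t1 t2 t3 : good t1 -> good t2 -> good t3 ->
  (tsize t3 <= tsize t2)%N -> (tsize t2 <= tsize t1)%N ->
  F_drawable (cost 2 (tsize (Node v t1 t2 t3))) (Node v t1 t2 t3).
Proof.
move=> [F1 G1 _] [F2 G2 _] [_ G3 _]; rewrite -(ler_nat R) -(ler_nat R (tsize t2)).
have c1 := @cost_le 2 (tsize t1) ltac:(lra).
have c2 := @cost_le 2 (tsize t2) ltac:(lra).
have d1 := @cost_le (72/25) (tsize t1) ltac:(lra).
have d2 := @cost_le (72/25) (tsize t2) ltac:(lra).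
have d3 := @cost_le (72/25) (tsize t3) ltac:(lra).
set x : R := (tsize t1)%:R in c1 d1 *; set y : R := (tsize t2)%:R in c2 d2 *.
set z : R := (tsize t3)%:R in d3 *; move=> zy yx.
have x0 : 0 <= x by apply: ler0n.
have y0 : 0 <= y by apply: ler0n.
have z0 : 0 <= z by apply: ler0n.
have eS : (tsize (Node v t1 t2 t3))%:R = x + y + z + 1 :> R.
  by rewrite /= -addn1 !natrD.
have pS := @pw_superadd R (x + y + z) 1 ltac:(lra) ltac:(lra).
rewrite pw1 in pS.
have [C|B] := lerP x (107/200 * (x + y + z) + 11/10 * z).
  apply: F_mono (F_split3 v G1 G2 G3); apply: le_cost; first lra.
  rewrite eS -natr1 !natrD; have := split3_le z0 zy yx C; lra.
apply: F_mono (F_beside v _ F1 F2 G3).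
  apply: le_cost; first lra.
  rewrite eS -natr1.
  rewrite beside_count !natrD; have := beside_le z0 zy yx (ltW B); lra.
move=> t1N; have x00 : x = 0 by rewrite /x t1N.
by move: B; rewrite x00; lra.
Qed.

Lemma G_node v t1 t2 t3 : good t1 -> good t2 -> good t3 ->
  (tsize t3 <= tsize t2)%N -> (tsize t2 <= tsize t1)%N ->
  G_drawable (cost (72/25) (tsize (Node v t1 t2 t3))) (Node v t1 t2 t3).
Proof.
move=> [_ G1 _] [_ _ K2] [_ G3 _].
have d1 := @cost_le (72/25) (tsize t1) ltac:(lra).
have d2 := @cost_le (69/25) (tsize t2) ltac:(lra).
have d3 := @cost_le (72/25) (tsize t3) ltac:(lra).
move=> s32 s21; have [t1s|t1s] := posnP (tsize t1).
  have nil t : tsize t = 0%N -> t = Nil by case: t.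
  have -> : t3 = Nil by apply: nil; lia.
  have -> : t2 = Nil by apply: nil; lia.
  have -> : t1 = Nil by apply: nil; lia.
  have K0 := @K_nil R V 1 isT.
  apply: G_mono (G_step v (@G_nil R V 0) K0 (@G_nil R V 0)).
  by apply: le_cost; rewrite /= ?add0n ?addn0 ?mulr1n ?pw1; lra.
have x1 : 1 <= (tsize t1)%:R :> R by rewrite ler1n.
move: s32 s21; rewrite -(ler_nat R) -(ler_nat R (tsize t2)).
set x : R := (tsize t1)%:R in d1 x1 *; set y : R := (tsize t2)%:R in d2 *.
set z : R := (tsize t3)%:R in d3 *; move=> zy yx.
have y0 : 0 <= y by apply: ler0n.
have z0 : 0 <= z by apply: ler0n.
have eS : (tsize (Node v t1 t2 t3))%:R = x + y + z + 1 :> R.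
  by rewrite /= -addn1 !natrD.
(* The rounding terms amount to 3 points, more than the 2.88 that superadditivity grants for the
   root. Comparing with the increment from 1 to 2 grants 2.88 * 3/2. *)
have pS := @pw_increment R 1 (x + y + z) 1 ltac:(lra) ltac:(lra) ltac:(lra).
have p2 : 5/2 <= pw (1 + 1) by apply: pw_ge; lra.
rewrite pw1 in pS.
apply: G_mono (G_step v G1 K2 G3); apply: le_cost; first lra.
rewrite eS.
rewrite G_count2 !natrD; have := G_le z0 zy yx; lra.
Qed.


Lemma spine_swap12 v (a b c : tree V) k w N :
  spine_drawable (Node v a b c) k w N -> spine_drawable (Node v b a c) k w N.
Proof.
by move=> h p W M T S Q C hW hT hS hN; apply: branch_swap12; apply: h C _ _ _ _.
Qed.

Lemma spine_swap23 v (a b c : tree V) k w N :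
  spine_drawable (Node v a b c) k w N -> spine_drawable (Node v a c b) k w N.
Proof.
by move=> h p W M T S Q C hW hT hS hN; apply: branch_swap23; apply: h C _ _ _ _.
Qed.

Definition good_children t : Prop :=
  if t is Node _ t1 t2 t3 then [/\ all_good t1, all_good t2 & all_good t3]
  else True.

(* [t] is the part of a tree of size [m] that remains after a spine has used
   up [E] vertices. *)
Definition cheap_spine t m E : Prop := exists a w N,
  [/\ spine_drawable t a w N,
      (a + w)%:R <= 19/25 * pw m%:R - 144/25 * pw E%:R + 2 &
      N%:R <= 69/25 * pw m%:R - 144/25 * pw E%:R + 1].

Lemma cheap_spine_swap12 v (a b c : tree V) m E :
  cheap_spine (Node v a b c) m E -> cheap_spine (Node v b a c) m E.
Proof.
by move=> [k [w [N [h h1 h2]]]]; exists k, w, N; split=> //; apply: spine_swap12.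
Qed.

Lemma cheap_spine_swap23 v (a b c : tree V) m E :
  cheap_spine (Node v a b c) m E -> cheap_spine (Node v a c b) m E.
Proof.
by move=> [k [w [N [h h1 h2]]]]; exists k, w, N; split=> //; apply: spine_swap23.
Qed.

(** 144/25 is the price 2 * 2.88 of a subtree hung by (G) on an unknown side; it also exceeds the
    price 2 of [t2] and the single point added for the root. Hence the growth of [pw E] pays for a
    step. *)
Lemma cheap_spine_node v t1 t2 t3 m E :
  good t1 -> good t2 -> good t3 ->
  (tsize t3 <= tsize t2)%N -> (tsize t2 <= tsize t1)%N ->
  (forall E', (tsize t1 + E' = m)%N -> (20 * E' <= m)%N -> cheap_spine t1 m E') ->
  (tsize (Node v t1 t2 t3) + E = m)%N -> (20 * E <= m)%N ->
  cheap_spine (Node v t1 t2 t3) m E.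
Proof.
move=> [_ G1 _] [F2 G2 _] [_ G3 _] s32 s21 IH em Em.
rewrite /= in em.
have m_pos : (0 < m)%N by lia.
have sum_le : (tsize t1 + tsize t2 + tsize t3 + E <= m)%N by lia.
have nat2e : (E = 0 \/ 2 * E <= tsize t1)%N by lia.
(* As long as the heavy child keeps 19/20 of [m], the vertices spent stay within [m / 20] and the
   spine goes on. *)
have [big|nbig] := leqP (19 * m) (20 * tsize t1).
  have [||a [w [N [sp haw hN]]]] := IH (E + 1 + tsize t2 + tsize t3)%N; try lia.
  have d1 := @cost_le (72/25) (tsize t1) ltac:(lra).
  have d2 := @cost_le (72/25) (tsize t2) ltac:(lra).
  have d3 := @cost_le (72/25) (tsize t3) ltac:(lra).
  have c2 := @cost_le 2 (tsize t2) ltac:(lra).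
  exists (a + cost 2 (tsize t2))%N, (w + (2 * cost (72/25) (tsize t3)).+1)%N.
  exists (N + cost 2 (tsize t2) + (2 * cost (72/25) (tsize t3)).+1)%N.
  split; first exact: spine_step.
    rewrite spine_count.
    have := @pw_superadd R (E + 1 + tsize t2)%:R (tsize t3)%:R (ler0n _ _) (ler0n _ _).
    have := @pw_superadd R (E + 1)%:R (tsize t2)%:R (ler0n _ _) (ler0n _ _).
    have := @pw_superadd R E%:R 1 (ler0n _ _) ltac:(lra).
    have y0 := pw_ge0 ((tsize t2)%:R : R).
    move: haw; rewrite !natrD pw1; lra.
  rewrite spine_total.
  have := @pw_superadd R (E + 1 + tsize t2)%:R (tsize t3)%:R (ler0n _ _) (ler0n _ _).
  have := @pw_superadd R (E + 1)%:R (tsize t2)%:R (ler0n _ _) (ler0n _ _).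
  have := @pw_superadd R E%:R 1 (ler0n _ _) ltac:(lra).
  have y0 := pw_ge0 ((tsize t2)%:R : R).
  move: hN; rewrite !natrD pw1; lra.
have d1 := @cost_le (72/25) (tsize t1) ltac:(lra).
have d2 := @cost_le (72/25) (tsize t2) ltac:(lra).
have d3 := @cost_le (72/25) (tsize t3) ltac:(lra).
have c2 := @cost_le 2 (tsize t2) ltac:(lra).
set x : R := (tsize t1)%:R in d1 *; set y : R := (tsize t2)%:R in d2 c2 *.
set z : R := (tsize t3)%:R in d3 *.
have zy : z <= y by rewrite ler_nat.
have yx : y <= x by rewrite ler_nat.
have z0 : 0 <= z by apply: ler0n.
have e0 : 0 <= E%:R :> R by apply: ler0n.
have M0 : 0 < m%:R :> R by rewrite ltr0n.
have eM : x + y + z + E%:R <= m%:R by rewrite -!natrD ler_nat.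
have eE : E%:R <= 1/20 * m%:R :> R.
  have : (20 * E)%:R <= m%:R :> R by rewrite ler_nat.
  by rewrite natrM; lra.
have x95 : x <= 19/20 * m%:R.
  have : (20 * tsize t1)%:R <= (19 * m)%:R :> R by rewrite ler_nat ltnW.
  by rewrite !natrM -/x; lra.
have e2 : E%:R = 0 :> R \/ 2 * E%:R <= x.
  by case: nat2e => [->|h]; [left|right; rewrite -natrM ler_nat].
have pE := pw_small M0 e0 eE.
have pM := pw_ge0 (m%:R : R).
(* The spine ends and the rest is drawn by (G) in one piece. The middle subtree uses (G) through
   [K_of_G]: the sharper (K) has one more rounding point, doubled by [G_step], which the [+ 1] of
   the budget does not cover. *)
have two : (3/5 * m%:R <= x \/ 7/100 * m%:R <= z) ->
    cheap_spine (Node v t1 t2 t3) m E.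
  move=> h; exists 0%N, 0%N.
  exists (cost (72/25) (tsize t1) +
    (2 * ((cost (72/25) (tsize t2)).+1 + cost (72/25) (tsize t3))).-1)%N.
  split; [exact: G_spine (G_step v G1 (K_of_G G2) G3)| by rewrite addn0; lra|].
  rewrite G_count.
  rewrite !natrD.
  suff : pw x + 2 * pw y + 2 * pw z + 2 * pw E%:R <= 23/24 * pw m%:R by lra.
  have [hx|hx] := lerP (3/5 * m%:R) x.
    by apply: lopsided_le => //; apply: ler0n.
  case: h => h; first lra.
  case: e2 => [e2|e2]; last exact: even_le.
  by apply: even_le => //; rewrite e2 mulr0; apply: ler0n.
have [hx|hx] := lerP (3/5 * m%:R) x; first by apply: two; left.
have [hz|hz] := lerP (7/100 * m%:R) z; first by apply: two; right.
have [b1 b2] := balanced_le (ler0n _ _ : 0 <= y) z0 e0 M0 eM yx (ltW hx) (ltW hz) eE.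
(* No dominant subtree and a small third one: a last step of the spine hangs [t2] and [t3], and (G)
   draws [t1] alone. *)
exists (0 + cost 2 (tsize t2))%N, (0 + (2 * cost (72/25) (tsize t3)).+1)%N.
exists (cost (72/25) (tsize t1) + cost 2 (tsize t2) +
  (2 * cost (72/25) (tsize t3)).+1)%N.
split; first by apply: spine_step F2 G3; apply: G_spine.
  by rewrite spine_count !natrD; lra.
by rewrite spine_total !natrD; lra.
Qed.

(** [m] stays fixed while [E] grows, since the budget refers to the whole tree in which the spine
    started. Any child may turn out to be the heaviest, so [P] assumes the induction hypothesis for
    all three symmetrically. *)
Lemma cheap_spineP t m E : good_children t -> (tsize t + E = m)%N ->
  (20 * E <= m)%N -> cheap_spine t m E.
Proof.
elim: t E => [|v t1 IH1 t2 IH2 t3 IH3] E.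
  move=> _ /= <- hE; have -> : E = 0%N by lia.
  exists 0%N, 0%N, 0%N; split; first by move=> *; left.
    by rewrite !addn0 pw0; lra.
  by rewrite !addn0 pw0; lra.
move=> /= [g1 g2 g3]; rewrite -/(all_good _).
pose P (a b c : tree V) := (forall t, t = a \/ t = b \/ t = c -> all_good t /\
    forall E', (tsize t + E' = m)%N -> (20 * E' <= m)%N -> cheap_spine t m E') ->
  ((tsize a + tsize b + tsize c).+1 + E = m)%N -> (20 * E <= m)%N ->
  cheap_spine (Node v a b c) m E.
suff : P t1 t2 t3.
  have gc t : all_good t -> good_children t by case: t => // ? ? ? ? [].
  apply=> t [->|[->|->]]; split=> // E' h1 h2; [apply: IH1|apply: IH2|apply: IH3];
    by [|apply: gc].
move: t1 t2 t3 {IH1 IH2 IH3 g1 g2 g3}; apply: (wlog_sorted (sz := @tsize V)).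
- move=> a b c h H e1 e2; apply: cheap_spine_swap12; apply: h => //; last lia.
  by move=> t ht; apply: H; tauto.
- move=> a b c h H e1 e2; apply: cheap_spine_swap23; apply: h => //; last lia.
  by move=> t ht; apply: H; tauto.
move=> a b c cb ba H e1 e2.
have [ga Ha] := H a (or_introl erefl).
have [gb _] := H b (or_intror (or_introl erefl)).
have [gc _] := H c (or_intror (or_intror erefl)).
by apply: cheap_spine_node Ha e1 e2 => //; apply: all_good_good.
Qed.

(** The two extra points are the [+ 2] of the strips in [cheap_spine] or, for the total, its [+ 1]
    together with the parent point. *)
Lemma K_node v t1 t2 t3 (t := Node v t1 t2 t3) : good_children t ->
  F_drawable (cost 2 (tsize t)) t -> K_drawable (cost (69/25) (tsize t)).+2 t.
Proof.
move=> gc F.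
have [a [w [N [sp haw hN]]]] : cheap_spine t (tsize t) 0.
  by apply: cheap_spineP gc _ _; rewrite ?addn0.
rewrite pw0 in haw hN.
have c0 := @cost_le 2 (tsize t) ltac:(lra).
have n1 : 1 <= (tsize t)%:R :> R by rewrite ler1n.
have p1 := pw_mono (ltac:(lra) : 0 <= 1 :> R) n1; rewrite pw1 in p1.
have le2 k : k%:R <= 69/25 * pw (tsize t)%:R + 2 ->
    (k <= (cost (69/25) (tsize t)).+2)%N.
  case: k => [|[|k]] // h; rewrite !ltnS; apply: le_cost; first lra.
  by move: h; rewrite -addn2 natrD; lra.
apply: K_of_spine sp F _ _ _.
- by apply: le2; move: haw; rewrite -natr1 natrD; have := ler0n R a; lra.
- apply: le2.
  by rewrite natrD -[(w + a)%N]addnC; lra.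
- by apply: le2; rewrite -natr1; lra.
Qed.

Lemma all_goodT t : all_good t.
Proof.
elim: t => [|v t1 IH1 t2 IH2 t3 IH3].
  split=> //; split; [exact: F_nil|exact: G_nil|exact: K_nil].
suff g : good (Node v t1 t2 t3) by [].
pose P (a b c : tree V) := all_good a -> all_good b -> all_good c ->
  good (Node v a b c).
suff : P t1 t2 t3 by apply.
move: t1 t2 t3 {IH1 IH2 IH3}; apply: (wlog_sorted (sz := @tsize V)).
- by move=> a b c h ga gb gc; apply: good_swap12; apply: h.
- by move=> a b c h ga gb gc; apply: good_swap23; apply: h.
move=> a b c cb ba ga gb gc.
have ga' := all_good_good ga; have gb' := all_good_good gb.
have gc' := all_good_good gc.
have hF : F_drawable (cost 2 (tsize (Node v a b c))) (Node v a b c) by exact: F_node.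
split=> //; first exact: G_node.
by apply: K_node hF; split.
Qed.

End Induction.

(** * From graphs to rooted trees *)

Section Labels.
Variable V : eqType.
Implicit Types (t : tree V) (u v w x y : V).

Fixpoint labels t : seq V :=
  if t is Node v a b c then v :: (labels a ++ (labels b ++ labels c)) else [::].

Definition is_root t x : bool := if t is Node v _ _ _ then x == v else false.

Fixpoint child t x y : bool :=
  if t is Node v a b c then
    [|| (x == v) && [|| is_root a y, is_root b y | is_root c y],
        child a x y, child b x y | child c x y]
  else false.

Lemma size_labels t : size (labels t) = tsize t.
Proof. by elim: t => //= v a <- b <- c <-; rewrite !size_cat; lia. Qed.

Lemma root_labels t x : is_root t x -> x \in labels t.
Proof. by case: t => //= v a b c /eqP->; rewrite mem_head. Qed.

Lemma child_labels t x y : child t x y -> x \in labels t /\ y \in labels t.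
Proof.
elim: t x y => //= v a IHa b IHb c IHc x y; rewrite !inE !mem_cat.
case/or4P => [/andP[/eqP-> /or3P[]/root_labels->]|/IHa[-> ->]|/IHb[-> ->]|
  /IHc[-> ->]]; by rewrite ?eqxx ?orbT.
Qed.

Lemma uniq_node v a b c : uniq (labels (Node v a b c)) ->
  [/\ uniq (labels a), uniq (labels b) & uniq (labels c)] /\
  [/\ v \notin labels a, v \notin labels b & v \notin labels c] /\
  [/\ forall x, x \in labels a -> x \in labels b -> False,
      forall x, x \in labels a -> x \in labels c -> False &
      forall x, x \in labels b -> x \in labels c -> False].
Proof.
rewrite /= !mem_cat !negb_or !cat_uniq has_cat negb_or.
move=> /andP[/and3P[va vb vc] /and3P[ua /andP[/hasPn ab /hasPn ac]
  /and3P[ub /hasPn bc uc]]].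
split; first by split.
split; first by split.
by split=> x xa xb; [have := ab x xb|have := ac x xb|have := bc x xb];
  rewrite /= xa.
Qed.

Ltac perm_count :=
  apply/permP=> ?; rewrite /= !count_cat /=;
  repeat match goal with
  | |- context [count ?f ?s] => move: (count f s) => ?
  | |- context [nat_of_bool ?b] => move: (nat_of_bool b) => ?
  end; ring.

Ltac bool_cases :=
  rewrite /= ?andbF ?orbF;
  repeat match goal with
  | |- context [child ?a ?x ?y] => case: (child a x y); rewrite /= ?orbT ?orbF //
  end;
  repeat match goal with
  | |- context [?x == ?y] => case: (x == y); rewrite /= ?orbT ?orbF //
  end;
  repeat match goal with
  | |- context [is_root ?a ?y] => case: (is_root a y); rewrite /= ?orbT ?orbF //
  end.

Definition leaf_added t u w t' : Prop :=
  [/\ perm_eq (labels t') (w :: labels t),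
      forall x y, child t' x y = child t x y || (x == u) && (y == w) &
      is_root t' =1 is_root t].

(** Records the neighbours of a node without a free slot: one more would make five, or give too many
    to a root of degree one. *)
Definition full_node t u : Prop := exists s : seq V,
  [/\ uniq s, size s = 3, all (child t u) s &
      is_root t u \/ exists2 z, z \notin s & child t z u].

Lemma add_leaf t u w : uniq (labels t) -> u \in labels t ->
  (exists t', leaf_added t u w t') \/ full_node t u.
Proof.
elim: t => //= v a IHa b IHb c IHc ut.
have [[ua ub uc] [[va vb vc] [dab dac dbc]]] := uniq_node ut.
have sub t0 : (forall x, x \in labels t0 -> x \in labels (Node v a b c)) ->
    v \notin labels t0 ->
    (forall x y, child t0 x y -> child (Node v a b c) x y) ->
    (forall y, is_root t0 y -> child (Node v a b c) v y) ->
    full_node t0 u -> full_node (Node v a b c) u.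
  move=> ls vt st rt [s [us ss /allP cs hs]]; exists s; split=> //.
    by apply/allP=> y /cs /st.
  right; case: hs => [/rt r|[z zs /st zu]]; last by exists z.
  by exists v => //; apply/negP=> /cs /child_labels[_]; apply/negP.
rewrite inE !mem_cat => /or4P[/eqP->{u IHa IHb IHc sub}|ua'|ub'|uc'].
- have root t0 : t0 = Nil \/ exists a0, is_root t0 a0.
    by case: t0 => [|a0 ? ? ?]; [left|right; exists a0; rewrite /= eqxx].
  have [Ea|[a0 ra]] := root a.
    left; exists (Node v (Node w Nil Nil Nil) b c); split=> //.
      by rewrite Ea; perm_count.
    by move=> x y; rewrite Ea; bool_cases.
  have [Eb|[b0 rb]] := root b.
    left; exists (Node v a (Node w Nil Nil Nil) c); split=> //.
      by rewrite Eb; perm_count.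
    by move=> x y; rewrite Eb; bool_cases.
  have [Ec|[c0 rc]] := root c.
    left; exists (Node v a b (Node w Nil Nil Nil)); split=> //.
      by rewrite Ec; perm_count.
    by move=> x y; rewrite Ec; bool_cases.
  right; exists [:: a0; b0; c0]; split=> //; last by left; rewrite /= eqxx.
    rewrite /= !inE negb_or andbT.
    have ma := root_labels ra; have mb := root_labels rb.
    have mc := root_labels rc.
    apply/andP; split; [apply/andP; split|]; apply/eqP=> h.
    + by apply: (dab a0) => //; rewrite h.
    + by apply: (dac a0) => //; rewrite h.
    + by apply: (dbc b0) => //; rewrite h.
  by rewrite /= !eqxx ra rb rc ?orbT.
- have [[t' [p1 p2 p3]]|f] := IHa ua ua'; last first.
    right; apply: sub f => //= [x xa|x y ->|y ->]; rewrite ?orbT //.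
      by rewrite inE mem_cat xa orbT.
    by rewrite eqxx.
  left; exists (Node v t' b c); split=> //=.
    apply/permP=> p; rewrite /= !count_cat (permP p1) /=; ring.
  by move=> x y; rewrite /= p2 p3; bool_cases.
- have [[t' [p1 p2 p3]]|f] := IHb ub ub'; last first.
    right; apply: sub f => //= [x xa|x y ->|y ->]; rewrite ?orbT //.
      by rewrite inE !mem_cat xa !orbT.
    by rewrite eqxx.
  left; exists (Node v a t' c); split=> //=.
    apply/permP=> p; rewrite /= !count_cat (permP p1) /=; ring.
  by move=> x y; rewrite /= p2 p3; bool_cases.
have [[t' [p1 p2 p3]]|f] := IHc uc uc'; last first.
  right; apply: sub f => //= [x xa|x y ->|y ->]; rewrite ?orbT //.
    by rewrite inE !mem_cat xa !orbT.
  by rewrite eqxx.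
left; exists (Node v a b t'); split=> //=.
  apply/permP=> p; rewrite /= !count_cat (permP p1) /=; ring.
by move=> x y; rewrite /= p2 p3; bool_cases.
Qed.

End Labels.

(** * A rooted ternary tree containing every vertex and every edge *)

Section SpanningTree.
Variables (n : nat) (e : rel 'I_n).
Local Notation V := 'I_n.
Implicit Types (t : tree V) (u v w x y : V).
Hypothesis eT : is_tree e.
Hypothesis e4 : max_degree_le e 4.

Let e_sym : symmetric e. Proof. by case: eT. Qed.
Let e_irr : irreflexive e. Proof. by case: eT => _ []. Qed.
Let e_conn x y : connect e x y. Proof. by case: eT => _ [_ []]. Qed.
Let e_acyc (c : seq V) : cycle e c -> uniq c -> (size c < 3)%N.
Proof. by case: eT => _ [_ [_]]; apply. Qed.

(** Such a root makes three slots per node suffice: every other vertex spends one of its four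
    neighbours on its parent. Without it, every path could be prolonged forever. *)
Lemma exists_leaf : (0 < n)%N -> exists r, (#|[set y | e r y]| <= 1)%N.
Proof.
move=> n0; have [/existsP//|/existsPn nl] :=
  boolP [exists r, #|[set y | e r y]| <= 1]%N.
have n2 x z : exists2 y, e x y & y != z.
  have := nl x; rewrite -ltnNge => /card_gt1P[y [y' [yx y'x yy']]].
  rewrite !inE in yx y'x; have [yz|yz] := eqVneq y z; last by exists y.
  by exists y' => //; rewrite -yz eq_sym.
have long k : exists x (p : seq V), [/\ path e x p, uniq (x :: p) & size p = k].
  elim: k => [|k [x [p [ep up sp]]]]; first by exists (Ordinal n0), [::].
  (* Avoiding the successor of [x] on the path ensures that a return to the path closes a cycle of
     at least three vertices; [x] is the default when [p] is empty. *)
  have [y xy yp] := n2 x (head x p).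
  have yx : y != x by apply: contraTneq xy => ->; rewrite e_irr.
  have [yp'|yp'] := boolP (y \in p); last first.
    exists y, (x :: p); split=> /=; [by rewrite e_sym xy| |by rewrite sp].
    by rewrite inE negb_or yx yp' -/(uniq (x :: p)).
  exfalso; case/path.splitP: yp' ep up yp => p1 p2.
  rewrite -cat_cons cat_path cat_uniq => /andP[ep1 _] /andP[up1 _] hy.
  have := @e_acyc (x :: rcons p1 y); rewrite /= rcons_path ep1 last_rcons e_sym xy.
  rewrite -/(uniq (x :: _)) up1 => /(_ isT isT); rewrite size_rcons.
  by case: p1 hy {ep1 up1} => //=; rewrite eqxx.
have [x [p [_ up sp]]] := long n.
by have := uniq_leq_size up (fun z _ => mem_enum V z); rewrite /= sp -cardE card_ord
  ltnn.
Qed.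

Definition subtree r t : Prop :=
  [/\ uniq (labels t), is_root t r & forall x y, child t x y -> e x y].

Lemma crossing_edge (A : pred V) x y : x \in A -> y \notin A ->
  exists u w, [/\ u \in A, w \notin A & e u w].
Proof.
move=> xA; have /connectP[p ep ->] := e_conn x y.
elim: p x xA ep => [|z p IH] x xA /=; first by rewrite xA.
move=> /andP[xz ep]; have [zA|zA] := boolP (z \in A); first exact: IH.
by exists x, z.
Qed.

Lemma spanning_subtree : (0 < n)%N -> exists r t,
  subtree r t /\ forall x, x \in labels t.
Proof.
move=> n0; have [r r1] := exists_leaf n0; exists r.
have grow k : (k < n)%N -> exists t, subtree r t /\ size (labels t) = k.+1.
  elim: k => [_|k IH kn].
    by exists (Node r Nil Nil Nil); split=> //; split=> //= x y; rewrite andbF.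
  have [t [[ut rt et] st]] := IH (ltnW kn).
  have [w wt] : exists w, w \notin labels t.
    apply/existsP; apply: contraLR kn; rewrite negb_exists => /forallP h.
    have : (size (enum V) <= size (labels t))%N.
      by apply: uniq_leq_size; [exact: enum_uniq|move=> z _; have := h z; rewrite negbK].
    by rewrite -cardE card_ord st -leqNgt.
  have {w wt} [u [w [ut' wt uw]]] :=
    @crossing_edge (mem (labels t)) r w (root_labels rt) wt.
  have [[t' [p1 p2 p3]]|[s [us ss /allP cs hs]]] := add_leaf w ut ut'.
    exists t'; split; last by rewrite (perm_size p1) /= st.
    split; [by rewrite (perm_uniq p1) /= wt ut|by rewrite p3|move=> x y].
    by rewrite p2 => /orP[/et|/andP[/eqP-> /eqP->]].
  have ws : w \notin s by apply: contra wt => /cs /child_labels[].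
  have bound (S : seq V) k0 : uniq S -> (forall y, y \in S -> e u y) ->
      (#|[set y | e u y]| <= k0)%N -> (size S <= k0)%N.
    move=> uS sS; apply: leq_trans; rewrite -(card_uniqP uS).
    by apply/subset_leq_card/subsetP => y /sS; rewrite inE.
  exfalso; case: hs => [ru|[z zs zu]].
    have ur : u = r.
      by case: (t) rt ru => //= ? ? ? ? /eqP-> /eqP->.
    have := bound (w :: s) 1%N; rewrite /= ws us ss ur r1 => /(_ isT).
    suff h : forall y, y \in w :: s -> e r y by move=> /(_ h isT).
    by move=> y; rewrite inE -ur => /orP[/eqP->//|/cs /et].
  have zw : z != w by apply: contraNneq wt => <-; case: (child_labels zu).
  have := bound (z :: w :: s) 4; rewrite /= inE negb_or zw zs ws us ss e4 => /(_ isT).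
  suff h : forall y, y \in [:: z, w & s] -> e u y by move=> /(_ h isT).
  move=> y; rewrite !inE => /or3P[/eqP->|/eqP->//|/cs /et //].
  by rewrite e_sym; apply: et.
have [t [Tt st]] := grow n.-1 ltac:(lia); exists t; split=> // x.
have [ut _ _] := Tt.
have [||_ ->] := uniq_min_size ut (_ : {subset labels t <= enum V}).
- by move=> z _; rewrite mem_enum.
- by rewrite -cardE card_ord st; lia.
by rewrite mem_enum.
Qed.

Definition tree_edge t : rel V := fun x y => child t x y || child t y x.

Lemma connect_root t r x : is_root t r -> x \in labels t ->
  connect (tree_edge t) r x.
Proof.
elim: t r x => //= v a IHa b IHb c IHc r x /eqP->.
have root t0 y : y \in labels t0 -> exists2 z, is_root t0 z & y \in labels t0.
  by case: t0 => //= z ? ? ? h; exists z.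
have step t0 : (forall r x, is_root t0 r -> x \in labels t0 ->
      connect (tree_edge t0) r x) ->
    (forall y z, child t0 y z -> child (Node v a b c) y z) ->
    (forall z, is_root t0 z -> child (Node v a b c) v z) ->
    x \in labels t0 -> connect (tree_edge (Node v a b c)) v x.
  move=> IH sub rt /root[z rz /(IH z _ rz) zx].
  apply: connect_trans (connect1 _) (connect_sub _ zx).
    by rewrite /tree_edge rt.
  move=> y y' h; apply: connect1; case/orP: h => /sub h;
    by rewrite /tree_edge h ?orbT.
rewrite inE !mem_cat => /or4P[/eqP->|h|h|h]; first exact: connect0.
- by apply: (step a) => //= [y z ->|z ->]; rewrite ?eqxx ?orbT.
- by apply: (step b) => //= [y z ->|z ->]; rewrite ?eqxx ?orbT.
- by apply: (step c) => //= [y z ->|z ->]; rewrite ?eqxx ?orbT.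
Qed.

(** An edge outside the tree would close a cycle with the tree path between its ends. Paths of
    length 0 and 1 are too short for a cycle: they mean a loop or a tree edge. *)
Lemma edges_of_spanning t r : subtree r t -> (forall x, x \in labels t) ->
  forall u v, e u v -> tree_edge t u v.
Proof.
move=> [ut rt et] all u v uv; apply: contraT => nuv; exfalso.
have ts : symmetric (tree_edge t) by move=> x y; rewrite /tree_edge orbC.
have te x y : tree_edge t x y -> e x y.
  by case/orP=> /et //; rewrite e_sym.
have : connect (tree_edge t) u v.
  apply: connect_trans (connect_root rt (all v)).
  by rewrite (sym_connect_sym ts); apply: connect_root rt (all u).
case/connectP => p0 ep0 ev; case/shortenP: ep0 ev => p ep up _ ev.
have := @e_acyc (u :: p); rewrite /= rcons_path (sub_path te ep) -ev e_sym uv.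
move=> /(_ isT up); case: p ep ev {up} => [_ /= vu|w [|//] /= /andP[uw _] vw _].
  by rewrite vu e_irr in uv.
by rewrite vw uw in nuv.
Qed.

End SpanningTree.

(** * The drawing of the graph *)

Section Layout.
Variables (R : realType) (V : eqType).
Local Notation pt := (R * R)%type.
Implicit Types (p q r z : pt) (Q : seq pt) (t : tree V) (Z : pt -> Prop).
Implicit Types (u v w x y : V) (L : seq V) (C : V -> V -> Prop).

(* The vertices [L] are placed by the relation [pos] at points of [Q] inside
   [Z]; the edges [C] are drawn as listed by [edg]; one more vertex [u], which
   may only be the parent end of an edge, lies at [p] outside [Z]. *)
Definition layout Q u p L C Z (pos : V -> pt -> Prop)
    (edg : V -> pt -> V -> pt -> bool -> Prop) : Prop :=
  [/\ [/\ forall x q, pos x q -> [/\ x \in L, q \in Q & Z q],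
          forall x, x \in L -> exists q, pos x q,
          forall x q q', pos x q -> pos x q' -> q = q' &
          forall x y q, pos x q -> pos y q -> x = y],
      forall x y, C x y -> exists q q' b, edg x q y q' b,
      forall x q y q' b, edg x q y q' b ->
        [/\ C x y, pos x q \/ (x = u /\ q = p), pos y q' &
            forall z, edge q q' b z -> (z = p /\ x = u) \/ Z z] &
      forall x1 q1 y1 q1' b1 x2 q2 y2 q2' b2 z,
        edg x1 q1 y1 q1' b1 -> edg x2 q2 y2 q2' b2 ->
        edge q1 q1' b1 z -> edge q2 q2' b2 z ->
        [/\ x1 = x2, y1 = y2 & b1 = b2] \/
        exists w, [/\ w = x1 \/ w = y1, w = x2 \/ w = y2 &
                      pos w z \/ (w = u /\ z = p)]].

Definition has_layout Q u p L C Z := exists pos edg, layout Q u p L C Z pos edg.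

Lemma layout_nil Q u p Z C : (forall x y, ~ C x y) -> has_layout Q u p [::] C Z.
Proof.
move=> nC; exists (fun _ _ => False), (fun _ _ _ _ _ => False).
by split=> // x y /nC.
Qed.

Lemma layout_ext Q u p L L' C C' Z Z' : L =i L' -> (forall x y, C x y <-> C' x y) ->
  included Z Z' -> has_layout Q u p L C Z -> has_layout Q u p L' C' Z'.
Proof.
move=> eL eC iZ [pos [edg [[h1 h2 h3 h4] h5 h6 h7]]]; exists pos, edg.
split=> //.
- split=> // [x q /h1[]|x]; first by rewrite eL => ? ? /iZ.
  by rewrite -eL => /h2.
- by move=> x y /eC /h5.
- move=> x q y q' b /h6[c ps py ez]; split=> //; first exact/eC.
  by move=> z /ez[?|/iZ]; [left|right].
Qed.

(** Outside disjoint regions the two parts have only [p], the place of the common parent [u], so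
    their edges can meet only there. *)
Lemma layout_union Q u p L1 L2 C1 C2 Z1 Z2 :
  separated Z1 Z2 -> ~ Z1 p -> ~ Z2 p ->
  (forall x, x \in L1 -> x \in L2 -> False) ->
  has_layout Q u p L1 C1 Z1 -> has_layout Q u p L2 C2 Z2 ->
  has_layout Q u p (L1 ++ L2) (fun x y => C1 x y \/ C2 x y)
    (fun z => Z1 z \/ Z2 z).
Proof.
move=> dZ n1 n2 dL [pos1 [edg1 [[a1 a2 a3 a4] a5 a6 a7]]]
  [pos2 [edg2 [[b1 b2 b3 b4] b5 b6 b7]]].
exists (fun x q => pos1 x q \/ pos2 x q).
exists (fun x q y q' b => edg1 x q y q' b \/ edg2 x q y q' b).
have cross x1 q1 y1 q1' k1 x2 q2 y2 q2' k2 z :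
    edg1 x1 q1 y1 q1' k1 -> edg2 x2 q2 y2 q2' k2 ->
    edge q1 q1' k1 z -> edge q2 q2' k2 z -> [/\ x1 = u, x2 = u & z = p].
  move=> /a6[_ _ _ e1] /b6[_ _ _ e2] /e1 z1 /e2 z2.
  case: z1 z2 => [[-> ->]|z1] [[zp ->]|z2] //.
  - by rewrite zp in z1.
  - by case: (dZ z).
split.
- split.
  + by move=> x q [/a1|/b1] [xL qQ Zq]; split=> //; rewrite ?mem_cat ?xL ?orbT //;
      [left|right].
  + by move=> x; rewrite mem_cat => /orP[/a2|/b2] [q h]; exists q; [left|right].
  + move=> x q q' [h|h] [h'|h']; [exact: a3 h h'| | |exact: b3 h h'].
    * by case: (a1 _ _ h) (b1 _ _ h') => xL _ _ [xL' _ _]; case: (dL x).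
    * by case: (b1 _ _ h) (a1 _ _ h') => xL _ _ [xL' _ _]; case: (dL x).
  + move=> x y q [h|h] [h'|h']; [exact: a4 h h'| | |exact: b4 h h'].
    * by case: (a1 _ _ h) (b1 _ _ h') => _ _ zq [_ _ zq']; case: (dZ q).
    * by case: (b1 _ _ h) (a1 _ _ h') => _ _ zq [_ _ zq']; case: (dZ q).
- by move=> x y [/a5|/b5] [q [q' [b h]]]; exists q, q', b; [left|right].
- move=> x q y q' b [/a6|/b6] [c ps py ez]; split; try tauto.
  + by move=> z /ez; tauto.
  + by move=> z /ez; tauto.
move=> x1 q1 y1 q1' k1 x2 q2 y2 q2' k2 z [h|h] [h'|h'] e1 e2.
- by case: (a7 _ _ _ _ _ _ _ _ _ _ _ h h' e1 e2) => [?|[w [? ? ?]]];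
    [left|right; exists w; split=> //; tauto].
- have [-> -> ->] := cross _ _ _ _ _ _ _ _ _ _ _ h h' e1 e2.
  by right; exists u; split; [left|left|right].
- have [-> -> ->] := cross _ _ _ _ _ _ _ _ _ _ _ h' h e2 e1.
  by right; exists u; split; [left|left|right].
- by case: (b7 _ _ _ _ _ _ _ _ _ _ _ h h' e1 e2) => [?|[w [? ? ?]]];
    [left|right; exists w; split=> //; tauto].
Qed.

Lemma edge_end p q b : edge p q b q.
Proof. by case: b; [right|right]; split=> //; rewrite /btw !lexx andbT /= le_total. Qed.

(** The new edge avoids [Z'], so it can meet the old ones only at [q], where [v] is placed. *)
Lemma layout_cons Q u p v q b L C Z Z' : q \in Q -> q != p -> v \notin L ->
  included Z' Z -> ~ Z' q -> ~ Z p ->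
  (forall z, edge p q b z -> z != p -> Z z /\ ~ Z' z) ->
  has_layout Q v q L C Z' ->
  has_layout Q u p (v :: L) (fun x y => C x y \/ (x = u /\ y = v)) Z.
Proof.
move=> qQ qp vL iZ nq np eZ [pos [edg [[a1 a2 a3 a4] a5 a6 a7]]].
have Zq : Z q by case: (eZ q (edge_end p q b) qp).
exists (fun x q' => pos x q' \/ (x = v /\ q' = q)).
exists (fun x q1 y q2 b' => edg x q1 y q2 b' \/
  [/\ x = u, q1 = p, y = v, q2 = q & b' = b]).
have cross x1 q1 y1 q1' k1 z : edg x1 q1 y1 q1' k1 -> edge q1 q1' k1 z ->
    edge p q b z -> x1 = v /\ z = q.
  move=> /a6[_ _ _ e1] /e1 [[-> ->] //|Zz] ez; exfalso.
  have [zp|zp] := eqVneq z p; first by apply: np; rewrite -zp; apply: iZ.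
  by have [_] := eZ z ez zp.
split.
- split.
  + move=> x q' [/a1[xL q'Q Zq']|[-> ->]]; split=> //; last exact: mem_head.
      by rewrite inE xL orbT.
    exact: iZ.
  + move=> x; rewrite inE => /orP[/eqP->|/a2[q' h]]; first by exists q; right.
    by exists q'; left.
  + move=> x q1 q2 [h|[-> ->]] [h'|[e ->]] //; first exact: a3 h h'.
      by case: (a1 _ _ h); rewrite e (negPf vL).
    by case: (a1 _ _ h'); rewrite (negPf vL).
  + move=> x y q1 [h|[-> eq]] [h'|[-> e]] //; first exact: a4 h h'.
      by case: (a1 _ _ h); rewrite e.
    by case: (a1 _ _ h'); rewrite eq.
- move=> x y [/a5[q1 [q2 [k h]]]|[-> ->]]; first by exists q1, q2, k; left.
  by exists p, q, b; right.
- move=> x q1 y q2 k [/a6[c ps py ez]|[-> -> -> -> ->]].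
    split; try tauto.
    by move=> z /ez[[-> _]|/iZ]; right.
  split; try tauto.
  move=> z ez; have [zp|zp] := eqVneq z p; first by left.
  by right; case: (eZ z ez zp).
move=> x1 q1 y1 q1' k1 x2 q2 y2 q2' k2 z [h|[-> -> -> -> ->]] [h'|[-> -> -> -> ->]] e1 e2.
- by case: (a7 _ _ _ _ _ _ _ _ _ _ _ h h' e1 e2) => [?|[w [? ? ?]]];
    [left|right; exists w; split=> //; tauto].
- have [-> ->] := cross _ _ _ _ _ _ h e1 e2.
  by right; exists v; split; [left|right|left; right].
- have [-> ->] := cross _ _ _ _ _ _ h' e2 e1.
  by right; exists v; split; [right|left|left; right].
- by left.
Qed.

Lemma draw_layout Q v a b c r Z : uniq (labels (Node v a b c)) ->
  draw Q (Node v a b c) r Z ->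
  has_layout Q v r (labels a ++ (labels b ++ labels c))
    (fun x y => child (Node v a b c) x y) Z.
Proof.
have main t : forall v a b c r Z, t = Node v a b c -> uniq (labels t) ->
    draw Q t r Z -> has_layout Q v r (labels a ++ (labels b ++ labels c))
    (fun x y => child t x y) Z; last exact: main.
elim: t => // v0 a0 IHa b0 IHb c0 IHc v1 a1 b1 c1 r0 Z0 [<- <- <- <-] ut.
move=> {v a b c r Z v1 a1 b1 c1}.
have [[ua ub uc] [[va vb vc] [dab dac dbc]]] := uniq_node ut.
have att t Z : (forall v a b c r Z, t = Node v a b c -> uniq (labels t) ->
    draw Q t r Z -> has_layout Q v r (labels a ++ (labels b ++ labels c))
      (fun x y => child t x y) Z) -> uniq (labels t) -> ~ Z r0 ->
    attach t (draw Q t) Q r0 Z ->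
    has_layout Q v0 r0 (labels t)
      (fun x y => child t x y \/ (x = v0 /\ is_root t y)) Z.
  case: t => [|v a b c] IH ut' nr [//|].
  - by move=> _; apply: layout_nil => x y [|[_]].
  - by move=> _; apply: layout_nil => x y [|[_]].
  move=> [q [k [Z' [qQ qr dr iZ eZ]]]].
  have nq : ~ Z' q by case: dr => ? [? [? []]].
  have vL : v \notin labels a ++ (labels b ++ labels c) by case/andP: ut'.
  apply: layout_ext (layout_cons v0 qQ qr vL iZ nq nr eZ (IH _ _ _ _ _ _ erefl ut' dr)).
  - by [].
  - by move=> x y; split=> -[h|[-> h]]; [left|right; split=> //=; apply/eqP|
      left|right; split=> //; apply/eqP].
  - by [].
move=> [Z1 [Z2 [Z3 [[i1 i2 i3] [d1 d2 d3] nr [b1 b2 b3]]]]].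
have n1 : ~ Z1 r0 by move/i1. have n2 : ~ Z2 r0 by move/i2.
have n3 : ~ Z3 r0 by move/i3.
have A := att _ _ IHa ua n1 b1. have B := att _ _ IHb ub n2 b2.
have C := att _ _ IHc uc n3 b3.
have BC := layout_union d3 n2 n3 dbc B C.
have d123 : separated Z1 (fun z => Z2 z \/ Z3 z).
  by move=> z z1 [|]; [apply: d1|apply: d2].
have n23 : ~ (Z2 r0 \/ Z3 r0) by case.
have dL x : x \in labels a0 -> x \in labels b0 ++ labels c0 -> False.
  by move=> xa; rewrite mem_cat => /orP[]; [apply: dab|apply: dac].
apply: layout_ext (layout_union d123 n1 n23 dL A BC) => //.
- move=> x y /=; split.
    by case=> [[->|[-> ->]]|[[->|[-> ->]]|[->|[-> ->]]]]; rewrite ?eqxx ?orbT.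
  case/or4P => [/andP[/eqP-> /or3P[]]|||]; tauto.
- by move=> z [/i1|[/i2|/i3]].
Qed.

Lemma child_not_root t x y : uniq (labels t) -> child t x y -> ~~ is_root t y.
Proof.
case: t => //= v a b c ut.
have [_ [[va vb vc] _]] := uniq_node ut.
move=> h; apply/eqP=> yv; subst y.
have : v \in labels a \/ v \in labels b \/ v \in labels c.
  case/or4P: h => [/andP[_ /or3P[]] /root_labels|/child_labels[_]|
    /child_labels[_]|/child_labels[_]]; tauto.
by rewrite (negPf va) (negPf vb) (negPf vc) => -[|[]].
Qed.

(** An edge has a unique orientation away from the root, which makes its bend independent of the
    order of its ends. *)
Lemma child_asym t x y : uniq (labels t) -> child t x y -> child t y x -> False.
Proof.
elim: t x y => // v a IHa b IHb c IHc x y ut xy yx.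
have := child_not_root ut xy; have := child_not_root ut yx; rewrite /= => xv yv.
have [[ua ub uc] [_ [dab dac dbc]]] := uniq_node ut.
move: xy yx; rewrite /= (negPf xv) (negPf yv) /=.
case/or3P=> h /or3P[] h'; try by [apply: IHa h h'|apply: IHb h h'|apply: IHc h h'];
  have [h1 _] := child_labels h; have [_ h2] := child_labels h'.
- exact: dab h1 h2.
- exact: dac h1 h2.
- exact: dab h2 h1.
- exact: dbc h1 h2.
- exact: dac h2 h1.
- exact: dbc h2 h1.
Qed.

End Layout.

(** * Parametrised segments and coordinate intervals *)

Section Coordinates.
Variable R : realType.
Local Notation pt := (R * R)%type.
Implicit Types (p q z : pt).

Definition corner p q (b : bool) : pt := if b then (p.1, q.2) else (q.1, p.2).

Lemma btw_interp (a b s : R) : 0 <= s <= 1 -> btw a b (a + s * (b - a)).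
Proof.
case/andP=> s0 s1; have s1' : 0 <= 1 - s by lra.
rewrite /btw; case: (lerP a b) => ab.
  have d0 : 0 <= b - a by lra.
  by have := mulr_ge0 s0 d0; have := mulr_ge0 s1' d0; move=> h1 h2; lra.
have d0 : 0 <= a - b by lra.
by have := mulr_ge0 s0 d0; have := mulr_ge0 s1' d0; move=> h1 h2; lra.
Qed.

Lemma on_seg_coord p q z : on_seg p q z -> btw p.1 q.1 z.1 /\ btw p.2 q.2 z.2.
Proof. by move=> [s [s01 ->]]; split; apply: btw_interp. Qed.

Lemma btw_eq (a x : R) : btw a a x -> x = a.
Proof. by rewrite /btw orbb => /andP[h1 h2]; apply/eqP; rewrite eq_le h2 h1. Qed.

Lemma on_L_edge p q b z : on_L p (corner p q b) q z -> edge p q b z.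
Proof.
rewrite /corner /edge; case: b => -[] /on_seg_coord /= [h1 h2].
- by left; split=> //; apply: btw_eq.
- by right; split=> //; apply: btw_eq.
- by left; split=> //; apply: btw_eq.
- by right; split=> //; apply: btw_eq.
Qed.

Lemma on_seg_sym p q z : on_seg p q z -> on_seg q p z.
Proof.
move=> [s [s01 ->]]; exists (1 - s); split; first lra.
by congr pair; lra.
Qed.

Lemma on_L_sym p k q z : on_L p k q z -> on_L q k p z.
Proof. by case=> /on_seg_sym; [right|left]. Qed.

End Coordinates.

Lemma enough_points (R : realType) (n m : nat) :
  (2 ^ 20 * n ^ 31 <= m ^ 20)%N -> (cost (2 : R) n <= m)%N.
Proof.
rewrite -(ler_nat R) natrM !natrX => h; rewrite -(ler_nat R).
apply: le_trans (cost_le n _) _; first lra.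
rewrite -(@ler_pXn2r _ 20) ?nnegrE //; first by rewrite exprMn pw_exp20.
by rewrite mulr_ge0 ?pw_ge0.
Qed.

(* |P| >= 2 n^{1.55} is written exactly as |P|^20 >= 2^20 * n^31 (1.55 = 31/20). *)
Theorem theorem5 (R : realType) (n : nat) (e : rel 'I_n) (P : seq (R * R)) :
  is_tree e -> max_degree_le e 4 -> gen_orth_pos P ->
  (2 ^ 20 * n ^ 31 <= (size P) ^ 20)%N ->
  exists (f : 'I_n -> R * R) (bend : 'I_n -> 'I_n -> R * R),
    planar_L_drawing e P f bend.
Proof.
move=> eT e4 gP szP; have [n0|n0] := posnP n.
  have nI (x : 'I_n) : False by case: x => i; rewrite n0.
  by exists (fun _ => (0, 0)), (fun _ _ => (0, 0)); split; [|split; [|split]] => x;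
    case: (nI x).
have [r [t [st all]]] := spanning_subtree eT e4 n0.
have [ut rt et] := st; have te := edges_of_spanning eT st all.
have tn : tsize t = n.
  rewrite -size_labels -(card_uniqP ut) -[RHS]card_ord.
  by apply: eq_card => x; rewrite all.
have [F _ _] := all_good_good (all_goodT R t).
have kP : (cost (2 : R) (tsize t) <= size P)%N by rewrite tn enough_points.
case: t => [//|v a b c] in st all rt ut et te tn F kP *.
have [//|[r0 [Z [r0P dr _ _]]]] := F P gP kP.
have nZ : ~ Z r0 by case: dr => ? [? [? []]].
have [pos [edg [[a1 a2 a3 a4] a5 a6 a7]]] := draw_layout ut dr.
have vL : v \notin labels a ++ (labels b ++ labels c) by case/andP: ut.
pose pos' x q := pos x q \/ (x = v /\ q = r0).
have pos'P x : exists q, pos' x q.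
  have := all x; rewrite /= inE => /orP[/eqP->|/a2[q h]]; first by exists r0; right.
  by exists q; left.
have [f fP] := boolp.choice pos'P.
have pos'_fun x q q' : pos' x q -> pos' x q' -> q = q'.
  move=> [h|[-> ->]] [h'|[xe ->]] //; first exact: a3 h h'.
    by have [] := a1 _ _ h; rewrite xe (negPf vL).
  by have [] := a1 _ _ h'; rewrite (negPf vL).
have f_inj : injective f.
  move=> x y; have := fP x; have := fP y.
  move=> [h|[-> eq]] [h'|[-> eq']] exy //.
  - by apply: a4 h' _; rewrite exy.
  - by have [_ _] := a1 _ _ h; rewrite -exy eq'.
  - by have [_ _] := a1 _ _ h'; rewrite exy eq.
set t := Node v a b c in st all rt ut et te tn F kP dr a5 a6 a7 *.
(* The layout is relational; choice fixes one port for each edge, with [true] as a dummy for other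
   pairs. *)
have flagP (xy : 'I_n * 'I_n) : exists k : bool,
    child t xy.1 xy.2 -> edg xy.1 (f xy.1) xy.2 (f xy.2) k.
  have [h|h] := boolP (child t xy.1 xy.2); last by exists true.
  have [q [q' [k ed]]] := a5 _ _ h; exists k => _.
  have [_ hq hq' _] := a6 _ _ _ _ _ ed.
  rewrite (pos'_fun _ _ _ (fP xy.1) (_ : pos' _ q)) //.
  by rewrite (pos'_fun _ _ _ (fP xy.2) (or_introl hq' : pos' _ q')).
have [k kP'] := boolp.choice flagP.
pose bend u w := if child t u w then corner (f u) (f w) (k (u, w))
  else corner (f w) (f u) (k (w, u)).
have orient u w : e u w -> exists x y, [/\ child t x y,
    (x = u /\ y = w) \/ (x = w /\ y = u) &
    forall z, on_L (f u) (bend u w) (f w) z -> edge (f x) (f y) (k (x, y)) z].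
  move=> /te /orP[h|h].
    exists u, w; split=> //; first by left.
    by move=> z; rewrite /bend h; apply: on_L_edge.
  exists w, u; split=> //; first by right.
  move=> z; rewrite /bend; case: ifP => [h'|_].
    by case: (child_asym ut h h').
  by move/on_L_sym; apply: on_L_edge.
exists f, bend; split; [exact: f_inj|split; [|split]].
- by move=> x; case: (fP x) => [/a1[_ ? _]|[_ ->]].
- move=> u w /te /orP[h|h]; rewrite /bend h.
    have nh : child t w u = false by apply/negP=> h'; apply: child_asym ut h h'.
    rewrite nh; split=> //; rewrite /corner.
    by case: (k _); [left|right].
  have nh : child t u w = false by apply/negP=> h'; apply: child_asym ut h h'.
  rewrite nh; split=> //; rewrite /corner.
  by case: (k _); [right|left].
move=> u w u' w' z /orient[x [y [cxy exy Exy]]] /orient[x' [y' [cxy' exy' Exy']]].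
move=> ne /Exy ez /Exy' ez'.
have := a7 _ _ _ _ _ _ _ _ _ _ _ (kP' (x, y) cxy) (kP' (x', y') cxy') ez ez'.
case=> [[xx yy _]|[s [s1 s2 ps]]].
  exfalso; apply: ne; rewrite /= in xx yy.
  by case: exy exy' => -[<- <-] [] [<- <-]; rewrite xx yy; tauto.
exists s; rewrite /= in s1 s2.
by split; [|split]; [case: exy s1 => -[-> ->]; tauto|
  case: exy' s2 => -[-> ->]; tauto|apply: pos'_fun ps (fP s)].
Qed.
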